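(* Let $\mu$ be a probability measure, with a moment of order one, on the group of affinities of an affine space $L$ (of dimension at least one over a local field $\mathrm{k}$) whose support does not fix any proper affine subspace. Assume that the Lyapunov exponent of the linear part of $\mu$ is negative (contracting case). Then the unique $\mu$-stationary probability measure $\nu$ on $L$ has a positive Hausdorff dimension.
   Context: $\mathrm{k}$ is a local field (Archimedean or not, of any characteristic). $L$ is a finite dimensional affine space over $\mathrm{k}$, identified with its underlying vector space by the choice of an origin; an affinity is an invertible map $x\mapsto Ax+b$ with $A\in\mathrm{GL}(L)$, $b\in L$. ''The support does not fix any proper affine subspace'' means that there is no affine subspace $\emptyset\ne M\subsetneq L$ (points included) with $gM=M$ for all $g$ in the support of $\mu$. The affine group is embedded in $\mathrm{GL}(L\oplus\mathrm{k})$ via $(x\mapsto Ax+b)\mapsto\begin{pmatrix}A&b\\0&1\end{pmatrix}$, and $\mu$ has a moment of order one if $\int\log^{+}\|g^{\pm1}\|\,d\mu(g)<\infty$, with $\|\cdot\|$ an operator norm on $\mathrm{End}(L\oplus\mathrm{k})$ and $\log^+=\max(\log,0)$. The Lyapunov exponent of the linear part means the top one, $\lim_n\frac1n\mathbb{E}(\log\|A_n\cdots A_1\|)$, where $A_1,A_2,\dots$ are i.i.d. with the law of the linear part $A$ of a random element of law $\mu$. A Borel probability measure $\nu$ on $L$ is $\mu$-stationary if $\iint f(g\cdot x)\,d\mu(g)\,d\nu(x)=\int f\,d\nu$ for every bounded continuous real function $f$ on $L$; under the hypotheses of the claim there is exactly one such $\nu$. The Hausdorff dimension of $\nu$ is the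 infimum of the Hausdorff dimensions of Borel sets of full $\nu$-measure. *)

(* Defs.v *)
From HB Require Import structures.
From mathcomp Require Import all_boot all_order all_algebra.
From mathcomp Require Import all_classical all_reals all_analysis.

Set Implicit Arguments.
Unset Strict Implicit.
Unset Printing Implicit Defensive.

Import Order.TTheory GRing.Theory Num.Theory.
Import numFieldNormedType.Exports.

Local Open Scope classical_set_scope.
Local Open Scope ring_scope.

(* The absolute value is a datum separate from the norm of a [numDomainType],
   since the latter would exclude non-Archimedean fields and fields of positive
   characteristic. *)
HB.mixin Record Field_hasAbsv (R : realType) K & GRing.Field K := {
  absv : K -> R ;
  absv_ge0 : forall x, 0 <= absv x ;
  absv_eq0 : forall x, (absv x == 0) = (x == 0) ;
  absvM : forall x y, absv (x * y) = absv x * absv y ;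
  absvD : forall x y, absv (x + y) <= absv x + absv y
}.

#[short(type="absvFieldType")]
HB.structure Definition AbsvField (R : realType) :=
  { K of GRing.Field K & Field_hasAbsv R K }.

Section absv_theory.
Context (R : realType) (K : absvFieldType R).
Implicit Types x y : K.

Lemma absv0 : absv (0 : K) = 0.
Proof. by apply/eqP; rewrite absv_eq0. Qed.

Lemma absv1 : absv (1 : K) = 1.
Proof.
by apply: (@mulfI _ (absv (1 : K))); rewrite ?absv_eq0 ?oner_eq0// -absvM !mulr1.
Qed.

Lemma absvN x : absv (- x) = absv x.
Proof.
have h : absv (-1 : K) = 1.
  apply/eqP; rewrite -(@pexpr_eq1 _ _ 2) ?absv_ge0//.
  by rewrite expr2 -absvM mulrNN mulr1 absv1.
by rewrite -mulN1r absvM h mul1r.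
Qed.

Definition absv_dist x y := absv (x - y).

Lemma absv_distxx x : absv_dist x x = 0.
Proof. by rewrite /absv_dist subrr absv0. Qed.

Lemma absv_dist_eq0 x y : absv_dist x y = 0 -> x = y.
Proof. by move=> /eqP; rewrite absv_eq0 subr_eq0 => /eqP. Qed.

Lemma absv_dist_sym x y : absv_dist x y = absv_dist y x.
Proof. by rewrite /absv_dist -opprB absvN. Qed.

Lemma absv_dist_triangle y x z :
  absv_dist x z <= absv_dist x y + absv_dist y z.
Proof. by rewrite /absv_dist (le_trans _ (absvD _ _))// addrA subrK. Qed.

HB.instance Definition _ := isMetric.Build R (AbsvField.sort K)
  absv_distxx absv_dist_eq0 absv_dist_sym absv_dist_triangle.

HB.instance Definition _ := isPointed.Build (AbsvField.sort K) 0.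

End absv_theory.

(* The topology of K is the one defined by its absolute value. *)
Definition local_field (R : realType) (K : absvFieldType R) : Prop :=
  (exists2 x : K, x != 0 & absv x != 1) /\ locally_compact [set: K].

Section matrix_metric.
Context (R : realType) (T : metricType R) (m n : nat).
Implicit Types x y : 'M[T]_(m, n).

Definition mx_dist x y : R :=
  \big[Num.max/0]_(i < m) \big[Num.max/0]_(j < n) mdist (x i j) (y i j).

Lemma mx_dist_le x y e :
  reflect (0 <= e /\ forall i j, mdist (x i j) (y i j) <= e) (mx_dist x y <= e).
Proof.
apply: (iffP (bigmax_leP _ _ _ _)) => [[e0 xye]|[e0 xye]]; split=> // i.
  by move=> j; have /bigmax_leP[_ /(_ j isT)] := xye i isT.
by move=> _; apply/bigmax_leP; split.
Qed.

Lemma mx_dist_ge0 x y : 0 <= mx_dist x y.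
Proof. by have /mx_dist_le[] := lexx (mx_dist x y). Qed.

Lemma mx_dist_eq0 x y : mx_dist x y = 0 -> x = y.
Proof.
move=> xy0; apply/matrixP => i j; apply: (@mdist_positivity R).
have /mx_dist_le[_ /(_ i j)] := lexx (mx_dist x y); rewrite xy0 => h.
by apply/eqP; rewrite eq_le h mdist_ge0.
Qed.

Lemma ball_mx_dist x d : ball x d = [set y | mx_dist x y < d].
Proof.
apply/seteqP; split => y /=.
  move=> [d0 xyd]; apply/bigmax_ltP; split=> // i _; apply/bigmax_ltP; split=> //.
  by move=> j _; have := xyd i j; rewrite ballEmdist.
move=> xyd; split=> [|i j]; first exact: le_lt_trans (mx_dist_ge0 x y) xyd.
rewrite ballEmdist /=; apply: le_lt_trans xyd.
by have /mx_dist_le[_ /(_ i j)] := lexx (mx_dist x y).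
Qed.

HB.instance Definition _ := PseudoMetric_isMetric.Build R 'M[T]_(m, n)
  mx_dist_ge0 mx_dist_eq0 ball_mx_dist.

End matrix_metric.

Notation borel T := (g_sigma_algebraType (@open T)).

Section hausdorff_dimension.
Context (R : realType) (T : metricType R).
Local Open Scope ereal_scope.

(* The maximum with 0 gives the empty set diameter 0 instead of -oo. *)
Definition diam (U : set T) : \bar R :=
  maxe 0 (ereal_sup [set (mdist x y)%:E | x in U & y in U]).

Definition hausdorff_premeasure (s delta : R) (E : set T) : \bar R :=
  ereal_inf [set \sum_(0 <= i <oo) diam (U i) `^ s | U in
    [set U : (set T)^nat | E `<=` \bigcup_i U i /\
                           forall i, diam (U i) <= delta%:E]].

Definition hausdorff_measure (s : R) (E : set T) : \bar R :=
  ereal_sup [set hausdorff_premeasure s delta E | delta in [set x | (0 < x)%R]].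

(* The infimum over s > 0 avoids the convention for 0 `^ 0; it is +oo when no
   Hausdorff measure of E vanishes, which does not happen in K^d. *)
Definition hausdorff_dim (E : set T) : \bar R :=
  ereal_inf [set s%:E | s in [set s | (0 < s)%R /\ hausdorff_measure s E = 0]].

Definition measure_hausdorff_dim (nu : set T -> \bar R) : \bar R :=
  ereal_inf [set hausdorff_dim E | E in
    [set E : set T | <<s @open T >> E /\ nu E = 1]].

End hausdorff_dimension.

Section affinities.
Context (R : realType) (K : absvFieldType R) (d : nat).

Definition affinity := {p : 'M[K]_d * 'cV[K]_d | p.1 \in unitmx}.

Definition linear_part (g : affinity) : 'M[K]_d := (val g).1.
Definition translation (g : affinity) : 'cV[K]_d := (val g).2.

Definition affinity_apply (g : affinity) (x : 'cV[K]_d) : 'cV[K]_d :=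
  linear_part g *m x + translation g.

Definition affinity_mx (g : affinity) : 'M[K]_(d + 1) :=
  block_mx (linear_part g) (translation g) 0 1%:M.

Definition affinity1 : affinity := Sub (1%:M, 0) (unitmx1 K d).

(* The affine group carries the subspace topology of End(L (+) K). *)
HB.instance Definition _ := Choice.on affinity.
HB.instance Definition _ := isPointed.Build affinity affinity1.
HB.instance Definition _ :=
  Topological.copy affinity (initial_topology affinity_mx).

Definition affine_subspace (M : set 'cV[K]_d) : Prop :=
  exists (p : 'cV[K]_d) (V : {vspace 'cV[K]_d}), M = [set x | x - p \in V].

Definition fixes (g : affinity) (M : set 'cV[K]_d) : Prop :=
  affinity_apply g @` M = M.

End affinities.

Section operator_norm.
Context (R : realType) (K : absvFieldType R) (n : nat).

(* L (+) K is K^(d + 1) with the maximum norm; any other norm changes log opnorm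
   by a bounded amount. *)
Definition vnorm (x : 'cV[K]_n) : R := \big[Num.max/0]_i absv (x i 0).

Definition opnorm (A : 'M[K]_n) : R :=
  sup [set vnorm (A *m x) / vnorm x | x in [set x | x != 0]].

End operator_norm.

Definition msupport (T : ptopologicalType) (R : realType)
    (mu : probability (borel T) R) : set T :=
  [set x | forall U : set T, open U -> U x -> (0 < mu U)%E].

Section iid.
Local Open Scope ereal_scope.
Context d (T : measurableType d) (R : realType) (mu : probability T R).

Definition tuple_cons n (x : T * n.-tuple T) : n.+1.-tuple T :=
  [the n.+1.-tuple T of x.1 :: x.2].

Lemma measurable_tuple_cons n : measurable_fun setT (@tuple_cons n).
Proof. exact: measurable_cons. Qed.

HB.instance Definition _ n :=
  isMeasurableFun.Build _ _ _ _ (@tuple_cons n) (@measurable_tuple_cons n).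

Section step.
Context n (P : probability (n.-tuple T) R).

Definition prod_law := mu \x P.

HB.instance Definition _ := Measure.on prod_law.

Lemma prod_law_setT : prod_law setT = 1.
Proof.
rewrite /prod_law -setXTT product_measure1E//.
by rewrite [X in X * _](probability_setT mu) [X in _ * X](probability_setT P) mule1.
Qed.

HB.instance Definition _ := Measure_isProbability.Build _ _ _ prod_law prod_law_setT.

End step.

(* The joint law of n independent random variables of law mu. *)
Fixpoint iid_law n : probability (n.-tuple T) R :=
  if n is n'.+1 then distribution (prod_law (iid_law n')) (@tuple_cons n')
  else dirac [tuple].

End iid.

Section random_affinities.
Local Open Scope ereal_scope.
Context (R : realType) (K : absvFieldType R) (d : nat).
Variable mu : probability (borel (affinity K d)) R.

Definition log_plus (x : R) : R := Num.max (ln x) 0%R.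

Definition moment_of_order_one : Prop :=
  \int[mu]_g (log_plus (opnorm (affinity_mx g)))%:E < +oo /\
  \int[mu]_g (log_plus (opnorm (invmx (affinity_mx g))))%:E < +oo.

(* A_n *m (... *m A_1), where A_1, ..., A_n are the linear parts of t. *)
Definition linear_prod n (t : n.-tuple (affinity K d)) : 'M[K]_d :=
  foldl (fun B g => linear_part g *m B) 1%:M t.

Definition lyapunov_exponent : \bar R :=
  limn (fun n => (n%:R^-1)%:E *
    \int[iid_law mu n]_t (ln (opnorm (linear_prod t)))%:E).

Definition stationary (nu : probability (borel 'cV[K]_d) R) : Prop :=
  forall f : 'cV[K]_d -> R, continuous f ->
    (exists C, forall x, (`|f x| <= C)%R) ->
    \int[nu]_x \int[mu]_g (f (affinity_apply g x))%:E = \int[nu]_x (f x)%:E.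

End random_affinities.

(* Main.v *)
Require Import Defs.
From mathcomp Require Import all_boot all_order all_algebra.
From mathcomp Require Import all_classical all_reals all_analysis.
From mathcomp Require Import measurable_realfun ring lra.

(** A random point z of law nu is sent by an independent random affinity h of law
    mu to a point of law nu; here h may be replaced by a product of many
    independent elements of law mu. As the Lyapunov exponent is negative, such a
    product contracts with probability close to 1 (negative_drift,
    contracting_block). Consequently nu has no atom: an atom of maximal mass would
    be unique, hence fixed by the support of mu (atomless). The images h 0, which
    are close to points of law nu, are then spread out: for a suitable delta, h 0
    lies in a given ball of radius 2 delta with probability at most 1/8, and the
    linear part A of h satisfies |A z| > delta with probability at most 1/16.

    With a moment of order one only, nu need not give mass O(r^s) to all balls of
    radius r, because of rare elements that expand or contract too much. It is
    enough to bound in this way a part of nu of mass 1/2, and this is done at each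
    finite time n. Apply n independent steps to z, and let a step cost
    2 * 1_(|A z| > delta) + B log_size h, where B > 0 is chosen to make the mean
    cost at most 1/2. Keep the trajectories for which, for every k, the last k steps
    cost at most k. Two facts hold for all n.
    - The trajectories that are kept have probability at least 1/2
      (chain_positive). This is the maximal ergodic inequality, which needs no
      more than the integrability of the cost.
    - Those of them that end in a set of diameter D have probability at most
      C D^s + (3/4)^n, where s = B ln 2 (chain_slab). Indeed the preimage of a set
      by h is larger by a factor at most exp (log_size h), which the second part of
      the cost controls; and a step that ends in a small set either sends 0 close
      to this set, which is unlikely, or has |A z| > delta and is expensive.

    If a set E of full measure had zero Hausdorff measure of exponent at most s,
    then finitely many balls with a small sum of s-th powers of radii would carry
    mass 3/4 for nu, hence 1/4 for the trajectories that are kept, for every n;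
    letting n tend to infinity contradicts the second fact. *)

Set Implicit Arguments.
Unset Strict Implicit.
Unset Printing Implicit Defensive.

Import Order.TTheory GRing.Theory Num.Theory.
Import numFieldNormedType.Exports.

Local Open Scope classical_set_scope.
Local Open Scope ring_scope.

(** * Norms, and the affine group *)

Section norms.
Context (R : realType) (K : absvFieldType R).

Lemma absv_sum n (F : 'I_n -> K) : absv (\sum_i F i) <= \sum_i absv (F i).
Proof.
elim/big_ind2 : _ => [|x1 x2 y1 y2 h1 h2|//]; first by rewrite absv0.
exact: le_trans (absvD _ _) (lerD h1 h2).
Qed.

Section vnorm.
Context (n : nat).
Implicit Types x y z : 'cV[K]_n.

Lemma vnorm_le x e :
  reflect (0 <= e /\ forall i, absv (x i 0) <= e) (vnorm x <= e).
Proof.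
by apply: (iffP (bigmax_leP _ _ _ _)) => [[e0 xe]|[e0 xe]]; split=> // i; apply: xe.
Qed.

Lemma vnorm_ge0 x : 0 <= vnorm x.
Proof. by have /vnorm_le[] := lexx (vnorm x). Qed.

Lemma absv_le_vnorm x i : absv (x i 0) <= vnorm x.
Proof. by have /vnorm_le[_] := lexx (vnorm x). Qed.

Lemma vnorm0 : vnorm (0 : 'cV[K]_n) = 0.
Proof.
apply/le_anti; rewrite vnorm_ge0 andbT; apply/vnorm_le; split=> // i.
by rewrite mxE absv0.
Qed.

Lemma vnorm_gt0 x : x != 0 -> 0 < vnorm x.
Proof.
move=> x0; rewrite lt_neqAle vnorm_ge0 andbT; apply: contra x0 => /eqP x0.
apply/eqP/colP => i; rewrite mxE; apply/eqP; rewrite -absv_eq0.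
by apply/eqP/le_anti; rewrite absv_ge0 andbT x0 absv_le_vnorm.
Qed.

Lemma vnormN x : vnorm (- x) = vnorm x.
Proof. by apply: eq_bigr => i _; rewrite mxE absvN. Qed.

Lemma vnormD x y : vnorm (x + y) <= vnorm x + vnorm y.
Proof.
apply/vnorm_le; split=> [|i]; first by rewrite addr_ge0 ?vnorm_ge0.
by rewrite mxE (le_trans (absvD _ _))// lerD// absv_le_vnorm.
Qed.

Lemma mdist_vnorm x y : mdist x y = vnorm (x - y).
Proof.
apply/le_anti/andP; split.
  apply/mx_dist_le; split=> [|i j]; first exact: vnorm_ge0.
  by have := absv_le_vnorm (x - y) i; rewrite !mxE ord1.
apply/vnorm_le; split=> [|i]; first exact: mx_dist_ge0.
by have /mx_dist_le[_ /(_ i 0)] := lexx (mx_dist x y); rewrite !mxE.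
Qed.

End vnorm.

Lemma vnorm_mul_bound m n (A : 'M[K]_(m, n)) (x : 'cV_n) C :
  0 <= C -> (forall i j, absv (A i j) <= C) ->
  vnorm (A *m x) <= n%:R * C * vnorm x.
Proof.
move=> C0 AC; apply/vnorm_le; split=> [|i].
  by rewrite !mulr_ge0// vnorm_ge0.
rewrite mxE (le_trans (absv_sum _))// -mulrA mulr_natl.
rewrite -[X in _ *+ X]card_ord -sumr_const ler_sum// => j _.
by rewrite absvM ler_pM ?absv_ge0// absv_le_vnorm.
Qed.

Section opnorm.
Context (n : nat).
Implicit Types (A B : 'M[K]_n) (x : 'cV[K]_n).

Let ratios A := [set vnorm (A *m x) / vnorm x | x in [set x | x != 0]].

Lemma opnorm_le A C : 0 <= C -> (forall x, vnorm (A *m x) <= C * vnorm x) ->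
  opnorm A <= C.
Proof.
move=> C0 AC; rewrite /opnorm -/(ratios A).
have [->|] := eqVneq (ratios A) set0; first by rewrite sup0.
move=> /set0P r0; apply: ge_sup => // _ [x /= x0 <-].
by rewrite ler_pdivrMr ?vnorm_gt0.
Qed.

Lemma opnormP A x : vnorm (A *m x) <= opnorm A * vnorm x.
Proof.
have [->|x0] := eqVneq x 0; first by rewrite mulmx0 !vnorm0 mulr0.
rewrite -ler_pdivrMr ?vnorm_gt0//; apply: ub_le_sup; last by exists x.
exists (n%:R * mx_dist A 0) => _ [y /= y0 <-].
rewrite ler_pdivrMr ?vnorm_gt0//; apply: vnorm_mul_bound => [|i j].
  exact: mx_dist_ge0.
have /mx_dist_le[_ /(_ i j)] := lexx (mx_dist A 0).
by rewrite /mdist/= /absv_dist mxE subr0.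
Qed.

Lemma opnorm_ge0 A : 0 <= opnorm A.
Proof.
rewrite /opnorm; set S := [set _ | _ in _].
have [->|/set0P[_ [x /= x0 _]]] := eqVneq S set0; first by rewrite sup0.
have := opnormP A x; rewrite -ler_pdivrMr ?vnorm_gt0//; apply: le_trans.
by rewrite divr_ge0 ?vnorm_ge0.
Qed.

Lemma opnormM A B : opnorm (A *m B) <= opnorm A * opnorm B.
Proof.
apply: opnorm_le => [|x]; first by rewrite mulr_ge0 ?opnorm_ge0.
rewrite -mulmxA (le_trans (opnormP _ _))// -mulrA ler_wpM2l ?opnorm_ge0//.
exact: opnormP.
Qed.

Lemma opnorm1 : opnorm (1%:M : 'M[K]_n) <= 1.
Proof. by apply: opnorm_le => // x; rewrite mul1mx mul1r. Qed.

Lemma opnorm_gt0 A : (0 < n)%N -> A \in unitmx -> 0 < opnorm A.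
Proof.
move=> n0 uA; pose x : 'cV[K]_n := const_mx 1.
have x0 : x != 0.
  apply/eqP => /colP /(_ (Ordinal n0)); rewrite !mxE => /eqP.
  by rewrite oner_eq0.
have Ax0 : A *m x != 0.
  by apply: contra x0 => /eqP h; rewrite -(mulKmx uA x) h mulmx0.
have := opnormP A x; rewrite leNgt; apply: contraNT; rewrite -leNgt => A0.
by rewrite (le_lt_trans _ (vnorm_gt0 Ax0))// mulr_le0_ge0// vnorm_ge0.
Qed.

End opnorm.

End norms.

Section log_plus.
Context (R : realType).
Implicit Types x y : R.

Lemma log_plus_ge0 x : 0 <= log_plus x.
Proof. by rewrite /log_plus le_max lexx orbT. Qed.

Lemma ln_le_log_plus x : ln x <= log_plus x.
Proof. by rewrite /log_plus le_max lexx. Qed.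

Lemma le_expR_log_plus x : x <= expR (log_plus x).
Proof.
have [x0|x0] := leP x 0; first exact: le_trans x0 (expR_ge0 _).
by rewrite -{1}(lnK x0) ler_expR ln_le_log_plus.
Qed.

Lemma log_plus_le x y : 0 <= y -> x <= expR y -> log_plus x <= y.
Proof.
move=> y0 xy; rewrite /log_plus ge_max y0 andbT.
have [x0|x0] := leP x 0; first by rewrite ln0.
by rewrite -ler_expR lnK.
Qed.

Lemma log_plusM x y z : 0 <= x -> 0 <= y -> z <= x * y ->
  log_plus z <= log_plus x + log_plus y.
Proof.
move=> x0 y0 zxy; apply: log_plus_le; first by rewrite addr_ge0 ?log_plus_ge0.
by rewrite expRD (le_trans zxy)// ler_pM// le_expR_log_plus.
Qed.

Lemma le_log_plus x y : x <= y -> log_plus x <= log_plus y.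
Proof.
by move=> xy; rewrite log_plus_le ?log_plus_ge0// (le_trans xy)// le_expR_log_plus.
Qed.

End log_plus.

Section affinities.
Context (R : realType) (K : absvFieldType R) (d : nat).
Implicit Types (g h : affinity K d) (x y : 'cV[K]_d).

Lemma linear_part_unit g : linear_part g \in unitmx.
Proof. exact: (valP g). Qed.

Lemma affinity_mul_subproof g h : linear_part g *m linear_part h \in unitmx.
Proof. by rewrite unitmx_mul !linear_part_unit. Qed.

Definition affinity_mul g h : affinity K d :=
  Sub (linear_part g *m linear_part h, affinity_apply g (translation h))
      (affinity_mul_subproof g h).

Lemma affinity_mulE g h x :
  affinity_apply (affinity_mul g h) x = affinity_apply g (affinity_apply h x).
Proof.
by rewrite /affinity_apply /linear_part /translation /= mulmxDr -mulmxA addrA.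
Qed.

Lemma affinity_mx_mul g h :
  affinity_mx (affinity_mul g h) = affinity_mx g *m affinity_mx h.
Proof.
rewrite /affinity_mx mulmx_block !mulmx0 !mul0mx !mulmx1 !addr0 !add0r.
by [].
Qed.

Lemma affinity_applyB g x y :
  affinity_apply g x - affinity_apply g y = linear_part g *m (x - y).
Proof. by rewrite /affinity_apply mulmxBr opprD addrACA subrr addr0. Qed.

Lemma vnorm_apply_inv g x y : vnorm (x - y) <=
  opnorm (invmx (linear_part g)) * vnorm (affinity_apply g x - affinity_apply g y).
Proof.
rewrite affinity_applyB (le_trans _ (opnormP _ _))//.
by rewrite mulKmx// linear_part_unit.
Qed.

(** Subadditive for products, it bounds both the expansion and the contraction
    of g on a logarithmic scale, and a moment of order one makes it integrable. *)
Definition log_size g : R :=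
  log_plus (opnorm (linear_part g)) + log_plus (opnorm (invmx (linear_part g))).

Lemma log_size_ge0 g : 0 <= log_size g.
Proof. by rewrite addr_ge0 ?log_plus_ge0. Qed.

Lemma log_size_mul g h : log_size (affinity_mul g h) <= log_size g + log_size h.
Proof.
rewrite /log_size /linear_part/= addrACA lerD//.
  by rewrite log_plusM ?opnorm_ge0// opnormM.
rewrite addrC log_plusM ?opnorm_ge0//.
rewrite (_ : invmx _ = invmx (linear_part h) *m invmx (linear_part g)) ?opnormM//.
have u := affinity_mul_subproof g h.
apply: (can_inj (mulKmx u)); rewrite mulmxV// mulmxA -[in RHS](mulmxA (linear_part g)).
by rewrite mulmxV ?linear_part_unit// mulmx1 mulmxV ?linear_part_unit.
Qed.

Lemma affinity_mx_unit g : affinity_mx g \in unitmx.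
Proof.
by rewrite unitmxE det_ublock det1 mulr1 -unitmxE linear_part_unit.
Qed.

Lemma vnorm_col_mx0 x : vnorm (col_mx x (0 : 'cV[K]_1)) = vnorm x.
Proof.
apply/le_anti/andP; split; apply/vnorm_le; split=> [|i]; rewrite ?vnorm_ge0//.
  rewrite -(splitK i); case: (fintype.split i) => j /=.
    by rewrite col_mxEu absv_le_vnorm.
  by rewrite col_mxEd mxE absv0 vnorm_ge0.
by rewrite -(col_mxEu x (0 : 'cV_1)) absv_le_vnorm.
Qed.

(** Both A and its inverse are blocks of the matrices acting on L (+) K. *)
Lemma log_size_le g : log_size g <=
  log_plus (opnorm (affinity_mx g)) + log_plus (opnorm (invmx (affinity_mx g))).
Proof.
have E x : affinity_mx g *m col_mx x 0 = col_mx (linear_part g *m x) 0.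
  by rewrite mul_block_col mulmx0 mul0mx addr0 mulmx0 addr0.
rewrite lerD// le_log_plus// opnorm_le ?opnorm_ge0// => x;
  rewrite -!(vnorm_col_mx0 x) -vnorm_col_mx0.
  by rewrite -E opnormP.
rewrite (_ : col_mx (invmx _ *m x) 0 = invmx (affinity_mx g) *m col_mx x 0).
  exact: opnormP.
apply: (can_inj (mulKmx (affinity_mx_unit g))).
by rewrite E mulKVmx ?linear_part_unit// mulKVmx// affinity_mx_unit.
Qed.

End affinities.

(** * Second countability and Borel sets *)

Section second_countable.

Lemma countable_image T U (f : T -> U) (A : set T) : countable A -> countable (f @` A).
Proof. exact: sub_countable (card_image_le f A). Qed.

Lemma dense_seq_second_countable (R : realType) (T : metricType R) (I : countType)
    (u : I -> T) :
  (forall x (e : R), 0 < e -> exists i, mdist x (u i) < e) ->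
  @second_countable T.
Proof.
move=> du; pose f (p : I * nat) : set T := (ball (u p.1) (p.2.+1%:R^-1 : R))°.
exists (range f); first exact: countable_image.
split=> [_ [p _ <-]|x V /nbhs_ballP[e /= e0 xeV]]; first exact: open_interior.
have [k] := @ltr_add_invr R 0 (e / 2) (divr_gt0 e0 (ltr0Sn R 1)).
rewrite add0r => ke.
have k0 : 0 < k.+1%:R^-1 :> R by [].
have [i xi] := du x _ (divr_gt0 k0 (ltr0Sn R 1)).
have k2 : k.+1%:R^-1 / 2 < k.+1%:R^-1 :> R.
  by rewrite ltr_pdivrMr// ltr_pMr// ltr1n.
exists (f (i, k)); first split; first by exists (i, k).
  rewrite /f /interior; apply/nbhs_ballP; exists (k.+1%:R^-1 / 2) => /=.
    by rewrite divr_gt0.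
  move=> y; rewrite !ballEmdist /= => xy.
  rewrite (le_lt_trans (metric_triangle _ x _))// [X in _ < X]splitr ltrD//.
  by rewrite metric_sym.
move=> y /interior_subset /=; rewrite ballEmdist /= => iy.
apply: xeV; rewrite ballEmdist /= (le_lt_trans (metric_triangle _ (u i) _))//.
by rewrite [e]splitr ltrD// (lt_trans _ ke)// (lt_trans xi).
Qed.

Lemma matrix_dense_seq (R : realType) (T : metricType R) (I : countType)
    (u : I -> T) m n :
  (forall x (e : R), 0 < e -> exists i, mdist x (u i) < e) ->
  forall (x : 'M[T]_(m, n)) (e : R), 0 < e ->
  exists i : 'M[I]_(m, n), mdist x (map_mx u i) < e.
Proof.
move=> du x e e0.
have /choice[f fP] (p : 'I_m * 'I_n) : exists i, mdist (x p.1 p.2) (u i) < e.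
  exact: du.
exists (\matrix_(i, j) f (i, j)).
have : ball x e (map_mx u (\matrix_(i, j) f (i, j))).
  split=> // i j; rewrite ballEmdist /= !mxE; exact: (fP (i, j)).
by rewrite ballEmdist.
Qed.

Lemma initial_second_countable (S : choiceType) (T : topologicalType) (f : S -> T) :
  @second_countable T -> @second_countable (initial_topology f).
Proof.
move=> [B cB [oB bB]]; exists ((fun A => f @^-1` A) @` B).
  exact: countable_image.
split=> [_ [A BA <-]|x V]; first by exists A => //; exact: oB.
rewrite nbhsE => -[U [[W oW <-] Wfx] UV].
have [A [BA Afx] AW] := bB (f x) W (open_nbhs_nbhs (conj oW Wfx)).
exists (f @^-1` A); first by split=> //; exists A.
by apply: subset_trans UV => y; exact: AW.
Qed.

(** Scaling by powers of an element of absolute value greater than 1 spreads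
    finite nets of a compact neighborhood of 0 over the whole field. *)
Lemma local_field_dense_seq (R : realType) (K : absvFieldType R) :
  local_field K ->
  exists (I : countType) (u : I -> K), forall x (e : R), 0 < e ->
    exists i, mdist x (u i) < e.
Proof.
case=> [[p0 p00 p01] /(_ 0 I)[C C0 [cC _]]].
have [p p1] : exists p : K, 1 < absv p.
  have [p1|p1|/eqP] := ltgtP (absv p0) 1; [|by exists p0|by rewrite (negbTE p01)].
  exists p0^-1; have a0 : 0 < absv p0.
    by rewrite lt_neqAle absv_ge0 eq_sym absv_eq0 p00.
  by rewrite -(ltr_pM2l a0) -absvM divff// mulr1 absv1.
have p0' : p != 0 by rewrite -(absv_eq0 p) gt_eqF// (lt_trans ltr01).
have absvX (x : K) n : absv (x ^+ n) = absv x ^+ n.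
  by elim: n => [|n ih]; rewrite ?expr0 ?absv1// !exprS absvM ih.
have /nbhs_ballP[r /= r0 rC] : nbhs (0 : K) C.
  by move: C0; rewrite /within /=; apply: filterS => x; apply.
have net k : exists s : seq K, forall x, C x ->
    exists2 y, y \in s & mdist x y < k.+1%:R^-1 :> R.
  move: cC; rewrite compact_cover.
  move=> /(_ K setT (fun z => (ball z (k.+1%:R^-1 : R))°)) [].
  - by move=> z _; exact: open_interior.
  - by move=> z _; exists z => //; apply: nbhsx_ballx.
  move=> D _ CD; exists (finmap.enum_fset D) => x /CD[z /= zD /interior_subset].
  by rewrite ballEmdist /= metric_sym; exists z.
have {net}/choice[s sP] := net.
exists (nat * (nat * nat))%type, (fun i => p ^+ i.1 * (s i.2.1)`_i.2.2) => x e e0.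
(* Bernoulli: |p|^n >= 1 + n (|p| - 1). *)
have [n nx] : exists n, absv x < absv p ^+ n * r.
  pose q := absv x / r / (absv p - 1).
  have p1' : 0 < absv p - 1 by rewrite subr_gt0.
  exists (Num.truncn q).+1; rewrite -ltr_pdivrMr//.
  have : 1 + (absv p - 1) *+ (Num.truncn q).+1 <= absv p ^+ (Num.truncn q).+1.
    elim: (Num.truncn q).+1 => [|k ih]; first by rewrite mulr0n expr0 addr0.
    rewrite mulrSr addrA exprSr.
    have : absv p ^+ k * absv p = absv p ^+ k + absv p ^+ k * (absv p - 1).
      by rewrite mulrBr mulr1 addrC subrK.
    move=> ->; rewrite lerD// ler_peMl ?(ltW p1')//.
    by rewrite exprn_ege1// ltW.
  apply: lt_le_trans; rewrite ltr_wpDl//.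
  by rewrite -mulr_natl -ltr_pdivrMr// truncnS_gt.
have pn0 : 0 < absv p ^+ n by rewrite exprn_gt0// (lt_trans ltr01).
have [k] := @ltr_add_invr R 0 (e / absv p ^+ n) (divr_gt0 e0 pn0).
rewrite add0r => ke.
have pnK : p ^+ n != 0 by rewrite expf_neq0.
have [|y ys xy] := sP k (x / p ^+ n).
  apply: rC; rewrite ballEmdist /= /mdist /= /absv_dist sub0r absvN.
  rewrite -(ltr_pM2l pn0) (le_lt_trans _ nx)// -absvX -absvM mulrC divfK//.
exists (n, (k, index y (s k))) => /=; rewrite nth_index//.
have -> : mdist x (p ^+ n * y) = absv p ^+ n * mdist (x / p ^+ n) y.
  rewrite /mdist /= /absv_dist -absvX -absvM; congr absv.
  by rewrite mulrBr [_ * (x / _)]mulrC divfK.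
by rewrite mulrC -ltr_pdivlMr// (lt_trans xy).
Qed.

End second_countable.

Section measurability.

Lemma countable_bigcup_measurable d (T : measurableType d) I (D : set I)
    (F : I -> set T) :
  countable D -> (forall i, D i -> measurable (F i)) ->
  measurable (\bigcup_(i in D) F i).
Proof.
move=> /countable_injP[f finj] mF.
have -> : \bigcup_(i in D) F i =
    \bigcup_n (\bigcup_(i in [set i | D i /\ f i = n]) F i).
  apply/seteqP; split=> [x [i Di Fx]|x [n _ [i [Di _] Fx]]]; last by exists i.
  by exists (f i) => //; exists i.
apply: bigcupT_measurable => n.
have [[i [Di fi]]|nD] := pselect (exists i, D i /\ f i = n); last first.
  rewrite (_ : \bigcup_(i in _) _ = set0)//.
  by apply/seteqP; split=> // x [i Di _]; apply: nD; exists i.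
rewrite (_ : \bigcup_(i in _) _ = F i); first exact: mF.
apply/seteqP; split=> [x [j [Dj fj]]|x Fx]; last by exists i.
by rewrite (finj i j) ?inE// fi fj.
Qed.

Lemma borel_measurable_fun d (T : measurableType d) (Z : ptopologicalType)
    (f : T -> borel Z) :
  (forall U : set Z, open U -> measurable (f @^-1` U)) -> measurable_fun setT f.
Proof.
by move=> fU; apply: (@measurability _ _ T (borel Z) setT f (@open Z)) => // _ [U oU <-];
  rewrite setTI; exact: fU.
Qed.

Lemma borel_open_measurable (X : ptopologicalType) (U : set X) :
  open U -> measurable (U : set (borel X)).
Proof. by move=> oU; exact: sub_sigma_algebra. Qed.

(** The product of the Borel sigma-algebras contains the open sets of the
    product only because countably many open rectangles suffice to write them. *)
Lemma continuous_prod_measurable (X Y Z : ptopologicalType) (F : X * Y -> Z) :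
  @second_countable X -> @second_countable Y -> continuous F ->
  measurable_fun setT (F : borel X * borel Y -> borel Z).
Proof.
move=> [BX cBX [oBX bBX]] [BY cBY [oBY bBY]] cF.
apply: borel_measurable_fun => U oU.
pose D := [set p : set X * set Y |
  [/\ BX p.1, BY p.2 & p.1 `*` p.2 `<=` F @^-1` U]].
have -> : F @^-1` U = \bigcup_(p in D) (p.1 `*` p.2).
  apply/seteqP; split=> [[x y] Uxy|z [p [_ _ pU] /pU//]].
  have : nbhs (x, y) (F @^-1` U).
    by apply: cF; apply: open_nbhs_nbhs.
  move=> [[V W] /= [xV yW] VWU].
  have [A [BA Ax] AV] := bBX x V xV.
  have [B [BB By] BW] := bBY y W yW.
  exists (A, B) => //; split=> // -[a b] [/= Aa Bb].
  by apply: VWU; split; [exact: AV|exact: BW].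
apply: countable_bigcup_measurable => [|[A B] [/= BA BB _]].
  by apply: sub_countable (countableX cBX cBY); apply: subset_card_le => p [].
by apply: measurableX; apply: borel_open_measurable; [exact: oBX|exact: oBY].
Qed.

Lemma measurable_fun_sublevel_closed (R : realType) (X : ptopologicalType)
    (f : X -> R) : (forall r, closed [set x | f x <= r]) ->
  measurable_fun setT (f : borel X -> R).
Proof.
move=> cf; apply: (measurability _ (RGenOInfty.measurableE R)) => // _ [_ [r ->] <-].
rewrite setTI (_ : _ @^-1` _ = ~` [set x | f x <= r]).
  by apply: borel_open_measurable; rewrite openC; exact: cf.
by apply/seteqP; split=> x /=; rewrite in_itv/= andbT ltNge => /negP.
Qed.

End measurability.

(** * Continuity and measurability of the affine action *)

Section absv_continuity.
Context (R : realType) (K : absvFieldType R).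
Context (T : Type) (F : set_system T) {FF : Filter F}.
Implicit Types f g : T -> K.

Lemma absv_cvgD f g (a b : K) : f @ F --> a -> g @ F --> b ->
  (fun t => f t + g t) @ F --> a + b.
Proof.
move=> fa gb; apply/metricType_numDomainType.cvgrPdist_lt => e e0; near=> t.
rewrite [e]splitr /mdist /= /absv_dist opprD addrACA.
rewrite (le_lt_trans (absvD _ _))// ltrD//; near: t.
  by move/metricType_numDomainType.cvgrPdist_lt : fa => /(_ (e / 2)); apply; rewrite divr_gt0.
by move/metricType_numDomainType.cvgrPdist_lt : gb => /(_ (e / 2)); apply; rewrite divr_gt0.
Unshelve. all: by end_near. Qed.

Lemma absv_cvgM f g (a b : K) : f @ F --> a -> g @ F --> b ->
  (fun t => f t * g t) @ F --> a * b.
Proof.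
move=> fa gb; apply/metricType_numDomainType.cvgrPdist_lt => e e0.
pose M := absv a + absv b + 1.
have M0 : 0 < M by rewrite ltr_wpDl// addr_ge0 ?absv_ge0.
pose u := Num.min 1 (e / 2 / M).
have u0 : 0 < u by rewrite lt_min ltr01 !divr_gt0.
have uM : u * M <= e / 2 by rewrite -ler_pdivlMr// ge_min lexx orbT.
near=> t.
have fu : mdist a (f t) < u.
  by near: t; move/metricType_numDomainType.cvgrPdist_lt : fa; exact.
have gu : mdist b (g t) < u.
  by near: t; move/metricType_numDomainType.cvgrPdist_lt : gb; exact.
have gM : absv (g t) <= M.
  have g1 : absv (g t - b) <= 1.
    rewrite -absvN opprB (le_trans (ltW gu))// ge_min lexx//.
  rewrite -[g t](subrK b) (le_trans (absvD _ _))// /M addrC lerD//.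
  by rewrite lerDr absv_ge0.
have aM : absv a <= M by rewrite /M -addrA lerDl addr_ge0 ?absv_ge0.
rewrite /mdist /= /absv_dist.
have -> : a * b - f t * g t = a * (b - g t) + (a - f t) * g t.
  by rewrite mulrBr mulrBl addrA subrK.
rewrite (le_lt_trans (absvD _ _))// !absvM [e]splitr.
apply: ltr_leD; last first.
  apply: le_trans uM; rewrite ler_pM ?absv_ge0//; exact: ltW.
apply: lt_le_trans uM.
rewrite mulrC (le_lt_trans (ler_wpM2l (absv_ge0 _) aM))// ltr_pM2r//.
Unshelve. all: by end_near. Qed.

Lemma absv_cvg_sum n (f : 'I_n -> T -> K) (a : 'I_n -> K) :
  (forall i, f i @ F --> a i) -> (fun t => \sum_i f i t) @ F --> \sum_i a i.
Proof.
move=> fa; elim: (index_enum _) => [|i s ih].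
  by rewrite big_nil (_ : (fun _ => _) = cst 0)//; [exact: cvg_cst|
    apply/funext => t; rewrite big_nil].
rewrite big_cons (_ : (fun _ => _) = fun t => f i t + \sum_(j <- s) f j t).
  exact: absv_cvgD.
by apply/funext => t; rewrite big_cons.
Qed.

Lemma absv_cvg_entry m n (f : T -> 'M[K]_(m, n)) (a : 'M[K]_(m, n)) i j :
  f @ F --> a -> (fun t => f t i j) @ F --> a i j.
Proof.
move=> /metricType_numDomainType.cvgrPdist_lt fa.
apply/metricType_numDomainType.cvgrPdist_lt => e /fa; apply: filterS => t.
apply: le_lt_trans.
by have /mx_dist_le[_ /(_ i j)] := lexx (mx_dist a (f t)).
Qed.

Lemma absv_cvg_mx m n (f : T -> 'M[K]_(m, n)) (a : 'M[K]_(m, n)) :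
  (forall i j, (fun t => f t i j) @ F --> a i j) -> f @ F --> a.
Proof.
move=> fa; apply/metricType_numDomainType.cvgrPdist_lt => e e0; near=> t.
suff : ball a e (f t) by rewrite ballEmdist.
split=> //; near: t; apply: filter_forall => i; apply: filter_forall => j.
move/metricType_numDomainType.cvgrPdist_lt : (fa i j) => /(_ _ e0).
by apply: filterS => t; rewrite ballEmdist.
Unshelve. all: by end_near. Qed.

Lemma absv_cvg_mulmx m n p (f : T -> 'M[K]_(m, n)) (g : T -> 'M[K]_(n, p))
    (a : 'M[K]_(m, n)) (b : 'M[K]_(n, p)) :
  f @ F --> a -> g @ F --> b -> (fun t => f t *m g t) @ F --> a *m b.
Proof.
move=> fa gb; apply: absv_cvg_mx => i j.
rewrite mxE; under eq_fun do rewrite mxE.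
by apply: absv_cvg_sum => k; apply: absv_cvgM; exact: absv_cvg_entry.
Qed.

Lemma absv_cvg_addmx m n (f g : T -> 'M[K]_(m, n)) (a b : 'M[K]_(m, n)) :
  f @ F --> a -> g @ F --> b -> (fun t => f t + g t) @ F --> a + b.
Proof.
move=> fa gb; apply: absv_cvg_mx => i j.
rewrite mxE; under eq_fun do rewrite mxE.
by apply: absv_cvgD; exact: absv_cvg_entry.
Qed.

Lemma vnorm_cvg n (f : T -> 'cV[K]_n) (a : 'cV[K]_n) : f @ F --> a ->
  (fun t => vnorm (f t)) @ F --> vnorm a.
Proof.
move=> /metricType_numDomainType.cvgrPdist_lt fa; apply/cvgrPdist_lt => e e0; near=> t.
have fe : vnorm (a - f t) < e by rewrite -mdist_vnorm; near: t; exact: fa.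
apply: le_lt_trans fe; rewrite ler_norml.
have h1 : vnorm (f t) <= vnorm a + vnorm (a - f t).
  by rewrite -[X in _ + X]vnormN opprB -{1}[f t](subrK a) addrC vnormD.
have h2 : vnorm a <= vnorm (a - f t) + vnorm (f t).
  by rewrite -{1}[a](subrK (f t)) vnormD.
by apply/andP; split; lra.
Unshelve. all: by end_near. Qed.

End absv_continuity.

Section affinity_continuity.
Context (R : realType) (K : absvFieldType R) (d : nat).

Lemma affinity_mx_continuous : continuous (@affinity_mx R K d).
Proof. exact: initial_continuous. Qed.

Lemma linear_part_continuous : continuous (@linear_part R K d).
Proof.
move=> g; apply: (@absv_cvg_mx _ _ _ _ (nbhs_filter g)) => i j.
rewrite -(block_mxEul (linear_part g) (translation g) 0 1%:M).
rewrite (_ : (fun _ => _) = fun h => affinity_mx h (lshift 1 i) (lshift 1 j)).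
  by apply: (@absv_cvg_entry _ _ _ _ (nbhs_filter g)); exact: affinity_mx_continuous.
by apply/funext => h; rewrite /affinity_mx block_mxEul.
Qed.

Lemma translation_continuous : continuous (@translation R K d).
Proof.
move=> g; apply: (@absv_cvg_mx _ _ _ _ (nbhs_filter g)) => i j.
rewrite -(block_mxEur (linear_part g) (translation g) 0 1%:M).
rewrite (_ : (fun _ => _) = fun h => affinity_mx h (lshift 1 i) (rshift d j)).
  by apply: (@absv_cvg_entry _ _ _ _ (nbhs_filter g)); exact: affinity_mx_continuous.
by apply/funext => h; rewrite /affinity_mx block_mxEur.
Qed.

Lemma linear_action_continuous :
  continuous (fun p : affinity K d * 'cV[K]_d => linear_part p.1 *m p.2).
Proof.
move=> p; apply: absv_cvg_mulmx; last exact: cvg_snd.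
by apply: cvg_comp; [exact: cvg_fst|exact: linear_part_continuous].
Qed.

Lemma affinity_apply_continuous :
  continuous (fun p : affinity K d * 'cV[K]_d => affinity_apply p.1 p.2).
Proof.
move=> p; apply: absv_cvg_addmx; first exact: linear_action_continuous.
by apply: cvg_comp; [exact: cvg_fst|exact: translation_continuous].
Qed.

Lemma affinity_mul_continuous :
  continuous (fun p : affinity K d * affinity K d => affinity_mul p.1 p.2).
Proof.
apply: (@continuous_comp_initial _ _ _ (@affinity_mx R K d)) => p.
rewrite (_ : _ \o _ = fun p => affinity_mx p.1 *m affinity_mx p.2); last first.
  by apply/funext => q /=; rewrite affinity_mx_mul.
apply: absv_cvg_mulmx.
  by apply: cvg_comp; [exact: cvg_fst|exact: affinity_mx_continuous].
by apply: cvg_comp; [exact: cvg_snd|exact: affinity_mx_continuous].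
Qed.

Lemma vnorm_continuous : continuous (@vnorm R K d).
Proof. by move=> x; apply: (@vnorm_cvg _ _ _ (nbhs x)); exact: cvg_id. Qed.

End affinity_continuity.

(** The operator norm is a supremum of continuous functions of the matrix, so
    its sublevel sets are closed; the inverse is handled in the same way, as the
    norm of the inverse is at most r iff |x| <= r |M x| for all x. *)
Section opnorm_measurability.
Context (R : realType) (K : absvFieldType R) (n : nat).
Context (X : ptopologicalType) (M : X -> 'M[K]_n).
Hypothesis cM : continuous M.

Let vnorm_mul_cont (x : 'cV[K]_n) : continuous (fun g => vnorm (M g *m x)).
Proof.
move=> g; apply: (@vnorm_cvg _ _ _ _ (nbhs_filter g)).
apply: (@absv_cvg_mulmx _ _ _ _ (nbhs_filter g)); last exact: cvg_cst.
exact: cM.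
Qed.

Lemma measurable_opnorm : measurable_fun setT (fun g : borel X => opnorm (M g)).
Proof.
apply: measurable_fun_sublevel_closed => r.
have [r0|r0] := leP 0 r; last first.
  rewrite (_ : [set _ | _] = set0); first exact: closed0.
  by apply/seteqP; split=> // g /=; rewrite leNgt (lt_le_trans r0)// opnorm_ge0.
rewrite (_ : [set _ | _] = \bigcap_x [set g | vnorm (M g *m x) <= r * vnorm x]).
  apply: closed_bigI => x _; have /continuous_closedP cl := @vnorm_mul_cont x.
  by apply: (cl [set t | t <= r * vnorm x]); exact: closed_le.
apply/seteqP; split=> g /= h.
  by move=> x _ /=; rewrite (le_trans (opnormP _ _))// ler_wpM2r// vnorm_ge0.
by apply: opnorm_le => // x; exact: (h x I).
Qed.

Lemma measurable_opnorm_inv : (forall g, M g \in unitmx) ->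
  measurable_fun setT (fun g : borel X => opnorm (invmx (M g))).
Proof.
move=> uM; apply: measurable_fun_sublevel_closed => r.
have [r0|r0] := leP 0 r; last first.
  rewrite (_ : [set _ | _] = set0); first exact: closed0.
  by apply/seteqP; split=> // g /=; rewrite leNgt (lt_le_trans r0)// opnorm_ge0.
rewrite (_ : [set _ | _] = \bigcap_x [set g | vnorm x <= r * vnorm (M g *m x)]).
  apply: closed_bigI => x _.
  have rc : continuous (fun g => r * vnorm (M g *m x)).
    by move=> g; apply: (@cvgM _ _ _ (nbhs_filter g));
      [exact: cvg_cst|exact: vnorm_mul_cont].
  have /continuous_closedP cl := rc.
  by apply: (cl [set t | vnorm x <= t]); exact: closed_ge.
apply/seteqP; split=> g /= h.
  move=> x _ /=; rewrite -{1}(mulKmx (uM g) x).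
  by rewrite (le_trans (opnormP _ _))// ler_wpM2r// vnorm_ge0.
apply: opnorm_le => // x; have := h (invmx (M g) *m x) I.
by rewrite /= mulKVmx.
Qed.

End opnorm_measurability.

Section affinity_measurability.
Context (R : realType) (K : absvFieldType R) (d : nat).
Notation G := (borel (affinity K d)).
Notation L := (borel 'cV[K]_d).

Lemma measurable_opnorm_linear :
  measurable_fun setT (fun g : G => opnorm (linear_part g)).
Proof. exact: measurable_opnorm (@linear_part_continuous R K d). Qed.

Lemma measurable_opnorm_inv_linear :
  measurable_fun setT (fun g : G => opnorm (invmx (linear_part g))).
Proof.
exact: measurable_opnorm_inv (@linear_part_continuous R K d) (@linear_part_unit R K d).
Qed.

Lemma measurable_log_plus : measurable_fun setT (@log_plus R).
Proof. by apply: measurable_maxr => //; exact: measurable_ln. Qed.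

Lemma measurable_log_size : measurable_fun setT (@log_size R K d : G -> R).
Proof.
apply: measurable_funD; apply: measurableT_comp => //.
- exact: measurable_log_plus.
- exact: measurable_opnorm_linear.
- exact: measurable_log_plus.
- exact: measurable_opnorm_inv_linear.
Qed.

Lemma measurable_vnorm : measurable_fun setT (@vnorm R K d : L -> R).
Proof.
apply: measurable_fun_sublevel_closed => r.
have /continuous_closedP cl := @vnorm_continuous R K d.
by apply: (cl [set t | t <= r]); exact: closed_le.
Qed.

Hypothesis hK : local_field K.

Lemma matrix_second_countable m n : @second_countable 'M[K]_(m, n).
Proof.
have [I [u du]] := local_field_dense_seq hK.
by apply: dense_seq_second_countable; apply: matrix_dense_seq du.
Qed.

Lemma affinity_second_countable : @second_countable (affinity K d).
Proof. exact: initial_second_countable (matrix_second_countable _ _). Qed.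

Lemma measurable_affinity_apply :
  measurable_fun setT (fun p : G * L => affinity_apply p.1 p.2 : L).
Proof.
apply: continuous_prod_measurable; [exact: affinity_second_countable|
  exact: matrix_second_countable|exact: affinity_apply_continuous].
Qed.

Lemma measurable_linear_action :
  measurable_fun setT (fun p : G * L => linear_part p.1 *m p.2 : L).
Proof.
apply: continuous_prod_measurable; [exact: affinity_second_countable|
  exact: matrix_second_countable|exact: linear_action_continuous].
Qed.

Lemma measurable_affinity_mul :
  measurable_fun setT (fun p : G * G => affinity_mul p.1 p.2 : G).
Proof.
apply: continuous_prod_measurable; [exact: affinity_second_countable|
  exact: affinity_second_countable|exact: affinity_mul_continuous].
Qed.

End affinity_measurability.

(** * Random images and independent samples *)

Section random_image.
Local Open Scope ereal_scope.
Context d1 d2 d3 (S : measurableType d1) (H : measurableType d2)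
  (S' : measurableType d3) (R : realType).
Variables (m : probability S R) (P : probability H R) (phi : S * H -> S').
Hypothesis mphi : measurable_fun setT phi.

(** The law of phi (X, Y) for independent X and Y of laws m and P. *)
Definition random_image : probability S' R :=
  distribution (m \x P) (mfun_Sub (mem_set mphi)).

Lemma random_imageE (F : S' -> \bar R) :
  measurable_fun setT F -> (forall x, 0 <= F x) ->
  \int[random_image]_y F y = \int[m]_x \int[P]_h F (phi (x, h)).
Proof.
move=> mF F0; rewrite ge0_integral_distribution//.
rewrite fubini_tonelli1//=; exact: measurableT_comp.
Qed.

Lemma random_image_swapE (F : S' -> \bar R) :
  measurable_fun setT F -> (forall x, 0 <= F x) ->
  \int[random_image]_y F y = \int[P]_h \int[m]_x F (phi (x, h)).
Proof.
move=> mF F0; rewrite ge0_integral_distribution//.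
rewrite fubini_tonelli2//=; exact: measurableT_comp.
Qed.

End random_image.

Section iid.
Local Open Scope ereal_scope.
Context dd (T : measurableType dd) (R : realType) (P : probability T R).

Lemma integral_iidS n (F : n.+1.-tuple T -> \bar R) :
  measurable_fun setT F -> (forall t, 0 <= F t) ->
  \int[iid_law P n.+1]_t F t =
  \int[P]_s \int[iid_law P n]_t F [tuple of s :: t].
Proof.
move=> mF F0; rewrite [LHS]ge0_integral_distribution//.
rewrite [LHS](@fubini_tonelli1 _ _ _ _ _ P (iid_law P n))//=.
by apply: measurableT_comp => //; exact: measurable_tuple_cons.
Qed.

Lemma integral_iid0 (F : 0.-tuple T -> \bar R) :
  measurable_fun setT F -> \int[iid_law P 0]_t F t = F [tuple].
Proof. by move=> mF; rewrite /= integral_dirac// diracT mul1e. Qed.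

Lemma measurable_sum_tuple n (f : T -> R) : measurable_fun setT f ->
  measurable_fun setT (fun t : n.-tuple T => (\sum_(s <- t) f s)%R).
Proof.
move=> mf; under eq_fun do rewrite big_tuple.
by apply: measurable_sum => i; exact: (measurableT_comp mf (measurable_tnth i)).
Qed.

Lemma measurable_prod_tuple n (f : T -> R) : measurable_fun setT f ->
  measurable_fun setT (fun t : n.-tuple T => (\prod_(s <- t) f s)%R).
Proof.
move=> mf; under eq_fun do rewrite big_tuple.
by apply: measurable_prod => i _; exact: (measurableT_comp mf (measurable_tnth i)).
Qed.

Lemma integral_iid_sum n (f : T -> R) : measurable_fun setT f ->
  (forall s, (0 <= f s)%R) ->
  \int[iid_law P n]_t (\sum_(s <- t) f s)%:E = n%:R%:E * \int[P]_s (f s)%:E.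
Proof.
move=> mf f0; elim: n => [|n ih].
  rewrite integral_iid0 ?big_nil ?mul0e//.
  by apply/measurable_EFinP; exact: measurable_sum_tuple.
rewrite integral_iidS; last 2 first.
- by apply/measurable_EFinP; exact: measurable_sum_tuple.
- by move=> t; rewrite lee_fin sumr_ge0.
under eq_integral => s _.
  under eq_integral do rewrite big_cons EFinD.
  rewrite ge0_integralD//=; last 3 first.
  - by move=> t _; rewrite lee_fin.
  - by move=> t _; rewrite lee_fin sumr_ge0.
  - by apply/measurable_EFinP; exact: measurable_sum_tuple.
  rewrite integral_cst// [X in _ * X]probability_setT mule1 ih.
  over.
rewrite ge0_integralD//=; last 3 first.
- by move=> s _; rewrite lee_fin.
- exact/measurable_EFinP.
- by move=> s _; rewrite mule_ge0// integral_ge0// => ? _; rewrite lee_fin.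
rewrite integral_cst// [X in _ * X]probability_setT mule1.
rewrite -[X in X + _]mul1e -ge0_muleDl// -?EFinD ?lee_fin// ?ler01//.
by rewrite -[n.+1]add1n natrD.
Qed.

Lemma integral_iid_prod n (f : T -> R) : measurable_fun setT f ->
  (forall s, (0 <= f s)%R) -> \int[P]_s (f s)%:E \is a fin_num ->
  \int[iid_law P n]_t (\prod_(s <- t) f s)%:E = (fine (\int[P]_s (f s)%:E) ^+ n)%:E.
Proof.
move=> mf f0 fP; elim: n => [|n ih].
  rewrite integral_iid0 ?big_nil//.
  by apply/measurable_EFinP; exact: measurable_prod_tuple.
rewrite integral_iidS; last 2 first.
- by apply/measurable_EFinP; exact: measurable_prod_tuple.
- by move=> t; rewrite lee_fin prodr_ge0.
under eq_integral => s _.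
  under eq_integral do rewrite big_cons EFinM.
  rewrite ge0_integralZl//; last 3 first.
  - by apply/measurable_EFinP; exact: measurable_prod_tuple.
  - by move=> t _; rewrite lee_fin prodr_ge0.
  - by rewrite lee_fin.
  rewrite ih muleC.
  over.
rewrite ge0_integralZl//; last 3 first.
- exact/measurable_EFinP.
- by move=> s _; rewrite lee_fin.
- by rewrite lee_fin exprn_ge0// fine_ge0// integral_ge0// => ? _; rewrite lee_fin.
by rewrite -{2}(fineK fP) -EFinM exprSr.
Qed.

End iid.

(** * Products of random affinities *)

Section affinity_monoid.
Context (R : realType) (K : absvFieldType R) (d : nat).
Implicit Types g h k : affinity K d.

Lemma affinity_eqP g h :
  linear_part g = linear_part h -> translation g = translation h -> g = h.
Proof.
rewrite /linear_part /translation => gh1 gh2; apply: val_inj.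
by case: (val g) (val h) gh1 gh2 => [a b] [a' b'] /= -> ->.
Qed.

Lemma translation_mul g h :
  translation (affinity_mul g h) = affinity_apply g (translation h).
Proof. by []. Qed.

Lemma affinity_mulA : associative (@affinity_mul R K d).
Proof.
move=> g h k; apply: affinity_eqP; first exact: mulmxA.
by rewrite !translation_mul affinity_mulE.
Qed.

Lemma affinity_mul1g : left_id (affinity1 K d) (@affinity_mul R K d).
Proof.
move=> g; apply: affinity_eqP; first exact: mul1mx.
by rewrite translation_mul /affinity_apply mul1mx addr0.
Qed.

Lemma affinity_mulg1 : right_id (affinity1 K d) (@affinity_mul R K d).
Proof.
move=> g; apply: affinity_eqP; first exact: mulmx1.
by rewrite translation_mul /affinity_apply mulmx0 add0r.
Qed.

Lemma affinity1_apply (x : 'cV[K]_d) : affinity_apply (affinity1 K d) x = x.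
Proof. by rewrite /affinity_apply /linear_part /translation /= mul1mx addr0. Qed.

Lemma log_size1 : log_size (affinity1 K d) = 0.
Proof.
have h : log_plus (opnorm (1%:M : 'M[K]_d)) = 0.
  apply/le_anti; rewrite log_plus_ge0 andbT.
  by rewrite log_plus_le// expR0 opnorm1.
by rewrite /log_size /linear_part /= invmx1 h addr0.
Qed.

Section tuple_affinity.
Context (T : Type) (a : T -> affinity K d).

(** The first entry of t acts first, which is the order of linear_prod. *)
Definition seq_affinity (t : seq T) : affinity K d :=
  foldl (fun g s => affinity_mul (a s) g) (affinity1 K d) t.

Lemma seq_affinity_cons s t :
  seq_affinity (s :: t) = affinity_mul (seq_affinity t) (a s).
Proof.
rewrite /seq_affinity /= affinity_mulg1.
have gen h u : foldl (fun g s => affinity_mul (a s) g) h u =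
    affinity_mul (foldl (fun g s => affinity_mul (a s) g) (affinity1 K d) u) h.
  elim: u h => [|s' u ih] h /=; first by rewrite affinity_mul1g.
  by rewrite ih [in RHS]ih affinity_mulg1 affinity_mulA.
exact: gen.
Qed.

Lemma log_size_seq t :
  log_size (seq_affinity t) <= \sum_(s <- t) log_size (a s).
Proof.
elim: t => [|s t ih]; first by rewrite big_nil [leLHS]log_size1.
rewrite seq_affinity_cons big_cons (le_trans (log_size_mul _ _))//.
by rewrite addrC lerD2l.
Qed.

End tuple_affinity.

End affinity_monoid.

Section random_affinity.
Context (R : realType) (K : absvFieldType R) (d : nat).
Hypothesis hK : local_field K.
Notation G := (borel (affinity K d)).
Notation L := (borel 'cV[K]_d).

(** Stationarity tested on nonnegative measurable functions, for an arbitrary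
    probability space driving the affinity: it then passes to products and
    applies to indicators. *)
Definition invariant_law dd (T : measurableType dd) (P : probability T R)
    (a : T -> affinity K d) (nu : probability L R) : Prop :=
  forall F : L -> \bar R, measurable_fun setT F -> (forall x, 0 <= F x)%E ->
  (\int[P]_t \int[nu]_x F (affinity_apply (a t) x) = \int[nu]_x F x)%E.

Context dd (T : measurableType dd) (P : probability T R) (a : T -> affinity K d).
Hypothesis ma : measurable_fun setT (a : T -> G).

Lemma measurable_sample_point :
  measurable_fun setT (fun p : T * L => (a p.1 : G, p.2)).
Proof.
apply: measurable_fun_pair => //=.
exact: (measurableT_comp ma measurable_fst).
Qed.

Lemma measurable_random_apply :
  measurable_fun setT (fun p : T * L => affinity_apply (a p.1) p.2 : L).
Proof.
exact: (measurableT_comp (measurable_affinity_apply hK) measurable_sample_point).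
Qed.

Lemma measurable_apply1 t :
  measurable_fun setT (fun x : L => affinity_apply (a t) x : L).
Proof. exact: (measurable_fun_pair2 t measurable_random_apply). Qed.

Lemma measurable_seq_affinity n :
  measurable_fun setT (fun t : n.-tuple T => seq_affinity a t : G).
Proof.
under eq_fun => t do rewrite -(map_tnth_enum t).
elim/last_ind: (enum 'I_n) => [|s i ih]; first exact: measurable_cst.
rewrite (_ : (fun _ => _) = fun t : n.-tuple T =>
  affinity_mul (a (tnth t i)) (seq_affinity a [seq tnth t i | i <- s])); last first.
  by apply/funext => t; rewrite map_rcons /seq_affinity foldl_rcons.
have m2 := measurable_affinity_mul hK (d := d).
apply: (measurableT_comp m2 (measurable_fun_pair _ ih)).
exact: (measurableT_comp ma (measurable_tnth i)).
Qed.

Lemma measurable_mean_apply (nu : probability L R) (F : L -> \bar R) :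
  measurable_fun setT F -> (forall x, 0 <= F x)%E ->
  measurable_fun setT (fun t => \int[nu]_x F (affinity_apply (a t) x))%E.
Proof.
move=> mF F0.
apply: (@measurable_fun_fubini_tonelli_F _ _ _ _ _ nu
  (fun p : T * L => F (affinity_apply (a p.1) p.2))) => //.
exact: (measurableT_comp mF measurable_random_apply).
Qed.

End random_affinity.

(** The image of a point of law nu under the first factor has law nu and is
    independent of the remaining factors. *)
Lemma invariant_law_tuple (R : realType) (K : absvFieldType R) (hK : local_field K)
    (d : nat) dd (T : measurableType dd) (P : probability T R)
    (a : T -> affinity K d) (nu : probability (borel 'cV[K]_d) R) n :
  measurable_fun setT (a : T -> borel (affinity K d)) ->
  invariant_law P a nu ->
  invariant_law (iid_law P n) (fun t => seq_affinity a t) nu.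
Proof.
move=> ma inv; elim: n => [|n ih] F mF F0; have mt := measurable_seq_affinity hK ma.
  rewrite integral_iid0; last exact: (measurable_mean_apply hK (mt 0%N)).
  by apply: eq_integral => x _; rewrite affinity1_apply.
pose phi m (t : m.-tuple T) :=
  (\int[nu]_x F (affinity_apply (seq_affinity a t) x))%E.
have mphi m : measurable_fun setT (phi m).
  exact: (measurable_mean_apply hK (mt m) nu mF F0).
have phi0 m t : (0 <= phi m t)%E by apply: integral_ge0 => x _; exact: F0.
rewrite (integral_iidS P (mphi n.+1) (phi0 n.+1)).
have mcons : measurable_fun setT (phi n.+1 \o @tuple_cons _ T n).
  exact: measurableT_comp (mphi n.+1) (@measurable_tuple_cons _ T n).
have swap := @fubini_tonelli _ _ _ _ _ P (iid_law P n) _ mcons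
  (fun p => phi0 n.+1 (tuple_cons p)).
etransitivity; first exact: swap.
rewrite -[RHS]ih//; apply: eq_integral => t _.
have mFt : measurable_fun setT
    (fun x : borel 'cV[K]_d => F (affinity_apply (seq_affinity a t) x)).
  exact: measurableT_comp mF (measurable_apply1 hK (mt n) t).
etransitivity; last exact: (inv _ mFt (fun x => F0 _)).
apply: eq_integral => s _; apply: eq_integral => x _.
by rewrite seq_affinity_cons affinity_mulE.
Qed.

(** * Random walks with negative drift *)

Section vanishing.
Local Open Scope ereal_scope.

Lemma exists_le_of_cvg0 (R : realType) (u : nat -> \bar R) (e : R) :
  u @ \oo --> 0 -> (0 < e)%R -> exists k, u k <= e%:E.
Proof.
move=> /fine_cvgP[fin] /cvgrPdist_lt ulim e0.
have [k _ /(_ k (leqnn k))[kfin ke]] : \forall k \near \oo,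
    u k \is a fin_num /\ (`|0 - fine (u k)| < e)%R.
  by apply: filterI; last exact: ulim.
exists k; rewrite -(fineK kfin) lee_fin.
by rewrite sub0r normrN in ke; rewrite (le_trans (ler_norm _))// ltW.
Qed.

Lemma exists_measure_le dd (T : measurableType dd) (R : realType)
    (P : probability T R) (A : nat -> set T) (e : R) :
  (forall k, measurable (A k)) -> {homo A : n m / (n <= m)%N >-> m `<=` n} ->
  P (\bigcap_k A k) = 0 -> (0 < e)%R -> exists k, P (A k) <= e%:E.
Proof.
move=> mA ndA PA0 e0; apply: exists_le_of_cvg0 e0.
rewrite -PA0; apply: nonincreasing_cvg_mu => //.
- by rewrite (le_lt_trans (probability_le1 P (mA 0%N)))// ltry.
- exact: bigcapT_measurable.
- by move=> n m nm; apply/subsetPset; exact: ndA.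
Qed.

End vanishing.

Section markov.
Context dd (T : measurableType dd) (R : realType) (P : probability T R).

Lemma measurable_superlevel (f : T -> R) (c : R) : measurable_fun setT f ->
  measurable [set x | c <= f x].
Proof.
move=> mf; rewrite (_ : [set _ | _] = setT `&` f @^-1` `[c, +oo[%classic).
  exact: mf.
by rewrite setTI; apply/seteqP; split=> x /=; rewrite in_itv/= andbT.
Qed.

Lemma measurable_sublevel (f : T -> R) (c : R) : measurable_fun setT f ->
  measurable [set x | f x <= c].
Proof.
move=> mf; rewrite (_ : [set _ | _] = setT `&` f @^-1` `]-oo, c]%classic).
  exact: mf.
by rewrite setTI; apply/seteqP; split=> x /=; rewrite in_itv.
Qed.

Lemma measurable_snd_gt0 : measurable [set p : T * R | 0 < p.2].
Proof.
rewrite (_ : [set _ | _] = setT `&` snd @^-1` `]0, +oo[%classic).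
  exact: (@measurable_snd _ _ T R).
by rewrite setTI; apply/seteqP; split=> p /=; rewrite in_itv/= andbT.
Qed.

Lemma ge0_markov (f : T -> R) (c e : R) : measurable_fun setT f ->
  (forall x, 0 <= f x) -> 0 < c -> (\int[P]_x (f x)%:E <= (c * e)%:E)%E ->
  (P [set x | (c <= f x)%R] <= e%:E)%E.
Proof.
move=> mf f0 c0 fe; have mA := measurable_superlevel c mf.
rewrite -(@lee_pmul2l _ c%:E)// -EFinM; apply: le_trans fe.
rewrite -[X in P X]setIT -integral_indic// -ge0_integralZl//; last first.
- by rewrite lee_fin ltW.
- by apply/measurable_EFinP; exact: measurable_indic.
apply: ge0_le_integral => //.
- by move=> x _; rewrite mule_ge0// lee_fin// ltW.
- by apply/measurable_EFinP; apply: measurable_funM => //; exact: measurable_indic.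
- exact/measurable_EFinP.
move=> x _; rewrite -EFinM lee_fin indicE.
case: (boolP (x \in _)) => [|_]; last by rewrite mulr0.
by rewrite inE mulr1.
Qed.

End markov.

Section drift.
Context dd (T : measurableType dd) (R : realType) (P : probability T R).

Lemma expR_le_quadratic (u : R) : u <= 2^-1 -> expR u <= 1 + u + 2 * u ^+ 2.
Proof.
move=> u2; have h : expR u * (1 - u) <= 1.
  by rewrite -ler_pdivlMl ?expR_gt0// mulr1 -expRN (le_trans _ (expR_ge1Dx _)).
have hp := expR_gt0 u.
have q0 : 0 <= 1 + u + 2 * u ^+ 2 by nra.
have q1 : 1 <= (1 - u) * (1 + u + 2 * u ^+ 2) by nra.
rewrite -[leLHS]mulr1 (le_trans (ler_wpM2l (ltW hp) q1))// mulrA.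
by rewrite -[leRHS]mul1r ler_wpM2r.
Qed.

Lemma integrable_tail (X : T -> R) (eta : R) :
  P.-integrable setT (EFin \o X) -> 0 < eta ->
  exists k : nat, (\int[P]_x (Num.max (`|X x| - k%:R) 0)%:E <= eta%:E)%E.
Proof.
move=> iX eta0; have mX : measurable_fun setT X.
  by apply/measurable_EFinP; exact: measurable_int iX.
have : (\int[P]_x (Num.max (`|X x| - k%:R) 0)%:E @[k --> \oo] -->
    \int[P]_x (cst 0%E x))%E.
  apply: (@dominated_cvg _ _ _ P setT _
    (fun (k : nat) x => (Num.max (`|X x| - k%:R) 0)%:E) (cst 0%E)
    (fun x => `|(X x)%:E|%E)) => //.
  - move=> k; apply/measurable_EFinP; apply: measurable_maxr => //.
    by apply: measurable_funB => //; exact: measurableT_comp.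
  - move=> x _; apply: cvg_near_cst.
    exists (Num.truncn `|X x|).+1 => // k /= kX; congr EFin; apply/max_idPr.
    rewrite subr_le0 (le_trans (ltW (truncnS_gt _)))// ler_nat//.
  - exact: integrable_abse.
  - move=> k x _; rewrite gee0_abs lee_fin; last by rewrite le_max lexx orbT.
    by rewrite ge_max normr_ge0 andbT gerBl.
by rewrite integral0 => /exists_le_of_cvg0; exact.
Qed.

(** A one-sided weak law of large numbers. Up to a tail Z of small mean,
    controlled by Markov's inequality, X is bounded; a bounded variable of
    negative mean has an exponential moment less than 1, whose powers tend to 0. *)
Lemma negative_drift (X : T -> R) (eps c : R) :
  P.-integrable setT (EFin \o X) -> (\int[P]_x (X x)%:E < 0)%E -> 0 < eps ->
  exists2 n : nat, (0 < n)%N &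
    (iid_law P n [set t | (c <= \sum_(s <- t) X s)%R] <= eps%:E)%E.
Proof.
move=> iX X0 eps0; have mX : measurable_fun setT X.
  by apply/measurable_EFinP; exact: measurable_int iX.
have finX : (\int[P]_x (X x)%:E)%E \is a fin_num by exact: integrable_fin_num.
pose l := - fine (\int[P]_x (X x)%:E)%E.
have l0 : 0 < l by rewrite oppr_gt0 -lte_fin fineK.
have XE : (\int[P]_x (X x)%:E = (- l)%:E)%E by rewrite /l opprK fineK.
have eta0 : 0 < Num.min (eps * l / 8) (l / 4).
  by rewrite lt_min !divr_gt0// mulr_gt0.
have [k] := integrable_tail iX eta0.
set Z := fun x => Num.max (`|X x| - k%:R) 0; move=> EZ.
have Z0 x : 0 <= Z x by rewrite le_max lexx orbT.
have mZ : measurable_fun setT Z.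
  apply: measurable_maxr => //.
  by apply: measurable_funB => //; exact: measurableT_comp.
have {EZ}[EZ1 EZ2] : (\int[P]_x (Z x)%:E <= (eps * l / 8)%:E /\
    \int[P]_x (Z x)%:E <= (l / 4)%:E)%E.
  by split; apply: le_trans EZ _; rewrite lee_fin ge_min lexx ?orbT.
(* W is X truncated at k and raised by l / 4; its mean is at most - l / 2. *)
pose M := k%:R + l.
have M0 : 0 < M by rewrite ltr_wpDl.
pose W x := Num.max (- k%:R) (Num.min k%:R (X x)) + l / 4.
have WM x : `|W x| <= M.
  rewrite (le_trans (ler_normD _ _))// lerD//.
    have k0 : 0 <= k%:R :> R by [].
    by rewrite ler_norml le_max lexx/= ge_max ge_min lexx andbT; lra.
  by rewrite ger0_norm ?divr_ge0 ?(ltW l0)// ler_pdivrMr// ler_peMr ?(ltW l0)// ler1n.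
have XWZ x : X x <= (W x - l / 4) + Z x.
  rewrite /W addrK /Z; have := normr_ge0 (X x); have := ler_norm (X x).
  rewrite /Num.max /Num.min; do ! case: ifPn; rewrite -?leNgt => *; lra.
have WXZ x : W x - l / 4 <= X x + Z x.
  rewrite /W addrK /Z; have := ler_norm (- X x); have := ler_norm (X x).
  rewrite normrN; have : 0 <= k%:R :> R by [].
  rewrite /Num.max /Num.min; do ! case: ifPn; rewrite -?leNgt => *; lra.
have mW : measurable_fun setT W.
  apply: measurable_funD => //; apply: measurable_maxr => //.
  exact: measurable_minr.
(* For this th the mean of expR (th * W) is less than 1: the linear term
   - th * l / 2 beats the quadratic one, 2 (th M)^2 = th * l / 4. *)
pose th := l / (8 * M ^+ 2).
have th0 : 0 < th by rewrite divr_gt0// mulr_gt0// exprn_gt0.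
have thM : th * M <= 8^-1.
  rewrite /th invfM expr2 invfM !mulrA divfK ?gt_eqF// ler_pdivrMr// mulrC.
  by rewrite ler_wpM2l// /M lerDr.
pose kap : R := fine (\int[P]_x (expR (th * W x))%:E)%E.
have mE : measurable_fun setT (fun x => expR (th * W x)).
  by apply: measurableT_comp => //; exact: measurable_funM.
have kapE : (\int[P]_x (expR (th * W x))%:E <= (1 - th * l / 4)%:E)%E.
  have iZ : P.-integrable setT (EFin \o Z).
    apply/integrableP; split; first exact/measurable_EFinP.
    apply: (@le_lt_trans _ _ (\int[P]_x (Z x)%:E)%E).
      by rewrite (eq_integral (EFin \o Z))// => x _ /=; rewrite ger0_norm.
    by rewrite (le_lt_trans EZ2)// ltry.
  pose u := 1 + th * l / 4 + 2 * (th * M) ^+ 2.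
  have iXZ : P.-integrable setT (fun x => (X x)%:E + (Z x)%:E)%E.
    exact: integrableD.
  have le1 x : expR (th * W x) <= u + th * (X x + Z x).
    have thW : `|th * W x| <= th * M by rewrite normrM gtr0_norm// ler_pM2l.
    have thW2 : (th * W x) ^+ 2 <= (th * M) ^+ 2.
      by rewrite -[leLHS]real_normK ?num_real// lerXn2r// nnegrE// (le_trans _ thW).
    have thWle : th * W x <= 2^-1.
      by rewrite (le_trans (ler_norm _))// (le_trans thW)// (le_trans thM)//; lra.
    have := ler_wpM2l (ltW th0) (WXZ x).
    have := expR_le_quadratic thWle; rewrite /u; lra.
  apply: (@le_trans _ _ (\int[P]_x (u%:E + th%:E * ((X x)%:E + (Z x)%:E))%E)%E).
    apply: ge0_le_integral => //.
    - exact/measurable_EFinP.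
    - apply/measurable_EFinP; apply: measurable_funD => //.
      by apply: measurable_funM => //; exact: measurable_funD.
    - by move=> x _; have := le1 x; rewrite -lee_fin EFinD EFinM EFinD.
  rewrite integralD//; last 2 first.
  - exact: finite_measure_integrable_cst.
  - exact: integrableZl.
  rewrite integral_cst// [X in (_ * X)%E]probability_setT mule1.
  rewrite integralZl// integralD// XE.
  have EZf : (\int[P]_x (Z x)%:E)%E \is a fin_num by exact: integrable_fin_num.
  move: EZ2; rewrite -(fineK EZf); move: (fine _) => z; rewrite lee_fin => EZ2.
  rewrite -[((- l)%:E + z%:E)%E]EFinD -[(th%:E * _)%E]EFinM -[(_ + _)%E]EFinD lee_fin.
  have thMM : (th * M) ^+ 2 = th * l / 8.
    by rewrite /th; field; rewrite gt_eqF.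
  have := ler_wpM2l (ltW th0) EZ2; rewrite /u thMM; nra.
have kapf : (\int[P]_x (expR (th * W x))%:E)%E \is a fin_num.
  rewrite ge0_fin_numE ?(le_lt_trans kapE) ?ltry//.
  by apply: integral_ge0 => x _; rewrite lee_fin expR_ge0.
have kap0 : 0 <= kap.
  by apply: fine_ge0; apply: integral_ge0 => x _; rewrite lee_fin expR_ge0.
have kap1 : kap < 1.
  rewrite -lte_fin /kap fineK// (le_lt_trans kapE)// lte_fin.
  by rewrite ltrBlDr ltrDl divr_gt0// mulr_gt0.
pose del := expR (th * c) * (eps / 2).
have del0 : 0 < del by rewrite mulr_gt0 ?expR_gt0// divr_gt0.
have /cvgrPdist_lt/(_ _ del0)[N _ /(_ N.+1 (leqnSn N))] : kap ^+ n @[n --> \oo] --> (0 : R).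
  by apply: cvg_expr; rewrite ger0_norm.
rewrite sub0r normrN ger0_norm ?exprn_ge0// => kapN.
exists N.+1 => //.
set n := N.+1 in kapN *.
have sub : [set t : n.-tuple T | (c <= \sum_(s <- t) X s)%R] `<=`
    [set t : n.-tuple T | (n%:R * (l / 4) <= \sum_(s <- t) Z s)%R] `|`
    [set t : n.-tuple T | (expR (th * c) <= \prod_(s <- t) expR (th * W s))%R].
  move=> t /= ct; have [|Zt] := leP (n%:R * (l / 4)) (\sum_(s <- t) Z s); first by left.
  right; rewrite -expR_sum ler_expR -mulr_sumr ler_pM2l//.
  have : \sum_(s <- t) X s <= \sum_(s <- t) (W s - l / 4 + Z s).
    by apply: ler_sum => s _; exact: XWZ.
  rewrite big_split /= sumrB big_const_seq count_predT size_tuple iter_addr_0.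
  by rewrite -mulr_natl; lra.
have mS := measurable_sum_tuple (n := n) mZ.
have mPr := measurable_prod_tuple (n := n) mE.
have mA := measurable_superlevel (n%:R * (l / 4)) mS.
have mB := measurable_superlevel (expR (th * c)) mPr.
have mC := measurable_superlevel c (measurable_sum_tuple (n := n) mX).
have n0 : 0 < n%:R :> R by rewrite ltr0n.
apply: (le_trans (le_measure _ _ _ sub)); rewrite ?inE//; first exact: measurableU.
apply: (le_trans (measureU2 _ _ _)) => //.
rewrite [eps]splitr EFinD; apply: leeD.
  apply: ge0_markov => //.
  - by move=> t; exact: sumr_ge0.
  - by rewrite mulr_gt0// divr_gt0.
  rewrite integral_iid_sum// (_ : _ * _ = n%:R * (eps * l / 8)); last by field.
  by rewrite EFinM lee_pmul2l// ltr0n.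
apply: ge0_markov => //.
- by move=> t; apply: prodr_ge0 => s _; exact: expR_ge0.
- exact: expR_gt0.
rewrite integral_iid_prod//.
by rewrite lee_fin ltW.
Qed.

End drift.

(** * Contraction in probability, and stationarity as invariance *)

Section contraction.
Context (R : realType) (K : absvFieldType R) (d : nat).
Hypothesis d0 : (0 < d)%N.
Implicit Types g : affinity K d.

Lemma opnorm_linear_gt0 g : 0 < opnorm (linear_part g).
Proof. exact: opnorm_gt0 d0 (linear_part_unit g). Qed.

Lemma abs_ln_opnorm_le g : `|ln (opnorm (linear_part g))| <= log_size g.
Proof.
have g0 := opnorm_linear_gt0 g.
rewrite ler_norml; apply/andP; split; last first.
  by rewrite (le_trans (ln_le_log_plus _))// lerDl log_plus_ge0.
rewrite lerNl; apply: (@le_trans _ _ (log_plus (opnorm (invmx (linear_part g))))).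
  rewrite -lnV ?posrE// (le_trans (ln_le_log_plus _))// le_log_plus//.
  rewrite -[leLHS]mulr1 ler_pdivrMl//.
  have o0 : 0 < opnorm (1%:M : 'M[K]_d) by rewrite opnorm_gt0// unitmx1.
  have := opnormM (1%:M : 'M[K]_d) 1%:M; rewrite mul1mx -[leLHS]mulr1 ler_pM2l// => o1.
  rewrite (le_trans o1)// -(mulmxV (linear_part_unit g)) opnormM//.
by rewrite lerDr log_plus_ge0.
Qed.

Lemma opnorm_seq_le T (a : T -> affinity K d) (t : seq T) :
  opnorm (linear_part (seq_affinity a t)) <=
  expR (\sum_(s <- t) ln (opnorm (linear_part (a s)))).
Proof.
elim: t => [|s t ih]; first by rewrite big_nil expR0 opnorm1.
rewrite seq_affinity_cons big_cons expRD lnK ?posrE ?opnorm_linear_gt0//.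
by rewrite (le_trans (opnormM _ _))// mulrC ler_wpM2l ?opnorm_ge0.
Qed.

Lemma contraction_in_probability dd (T : measurableType dd) (P : probability T R)
    (a : T -> affinity K d) (r eps : R) :
  P.-integrable setT (fun s => (ln (opnorm (linear_part (a s))))%:E) ->
  (\int[P]_s (ln (opnorm (linear_part (a s))))%:E < 0)%E ->
  0 < r -> 0 < eps -> exists n : nat, forall A,
    measurable A ->
    A `<=` [set t : n.-tuple T | (r <= opnorm (linear_part (seq_affinity a t)))%R] ->
    (iid_law P n A <= eps%:E)%E.
Proof.
move=> iX X0 r0 eps0; have [n _ nP] := negative_drift (ln r) iX X0 eps0.
exists n => A mA Ar; apply: le_trans nP; apply: le_measure; rewrite ?inE//.
  apply: measurable_superlevel; apply: measurable_sum_tuple.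
  by apply/measurable_EFinP; exact: measurable_int iX.
move=> t /Ar /= rt; rewrite -ler_expR lnK ?posrE//.
exact: le_trans rt (opnorm_seq_le _ _).
Qed.

End contraction.

(** The distance to a closed set supplies the continuous functions needed to
    test equality of measures. *)
Section distance_to_set.
Context (R : realType) (K : absvFieldType R) (d : nat).
Notation L := ('cV[K]_d).
Variables (F : set L) (F0 : F !=set0).

Definition dist_to (x : L) : R := inf [set vnorm (x - y) | y in F].

Let has_inf_dist x : has_inf [set vnorm (x - y) | y in F].
Proof.
split; first by case: F0 => y Fy; exists (vnorm (x - y)), y.
by exists 0 => _ [y _ <-]; exact: vnorm_ge0.
Qed.

Lemma dist_to_ge0 x : 0 <= dist_to x.
Proof.
apply: lb_le_inf; first by case: (has_inf_dist x).
by move=> _ [y _ <-]; exact: vnorm_ge0.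
Qed.

Lemma dist_to_lip x z : dist_to x <= dist_to z + vnorm (x - z).
Proof.
rewrite -lerBlDr; apply: lb_le_inf; first by case: (has_inf_dist z).
move=> _ [y Fy <-]; rewrite lerBlDr.
apply: (@le_trans _ _ (vnorm (x - y))).
  by apply: ge_inf; [case: (has_inf_dist x)|exists y].
by rewrite -[x](subrK z) -addrA addrC (le_trans (vnormD _ _)) ?subrK.
Qed.

Lemma dist_to_continuous : continuous dist_to.
Proof.
move=> x; apply/(@cvgrPdist_lt _ _ _ _ (nbhs_filter x)) => e e0.
have : \forall y \near x, mdist x y < e.
  by apply/metricType_numDomainType.nbhs_mdistP; exists e.
apply: (@filterS _ _ (nbhs_filter x)) => y; rewrite mdist_vnorm; apply: le_lt_trans.
rewrite ler_distl.
have := dist_to_lip x y; have := dist_to_lip y x.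
by rewrite -[vnorm (y - x)]vnormN opprB => *; apply/andP; split; lra.
Qed.

Lemma dist_to_mem x : F x -> dist_to x = 0.
Proof.
move=> Fx; apply/le_anti; rewrite dist_to_ge0 andbT.
rewrite -(vnorm0 K d) -(subrr x); apply: ge_inf; [by case: (has_inf_dist x)|].
by exists x.
Qed.

Lemma dist_to_gt0 x : closed F -> ~ F x -> 0 < dist_to x.
Proof.
move=> cF nFx; have : nbhs x (~` F).
  by apply: open_nbhs_nbhs; split=> //; rewrite openC.
move=> /metricType_numDomainType.nbhs_mdistP[e /= e0 eF].
apply: lt_le_trans e0 _; apply: lb_le_inf; first by case: (has_inf_dist x).
move=> _ [y Fy <-]; rewrite leNgt; apply/negP => xy.
by apply: (eF y) => //=; rewrite mdist_vnorm.
Qed.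

End distance_to_set.

Section stationary.
Context (R : realType) (K : absvFieldType R) (d : nat).
Notation L := (borel 'cV[K]_d).

(** The functions min(1, k dist(x, complement of U)) increase to the indicator
    of the open set U, and open sets determine a probability. *)
Lemma eq_probability_continuous (m1 m2 : probability L R) :
  (forall f : 'cV[K]_d -> R, continuous f -> (forall x, 0 <= f x <= 1)%R ->
    \int[m1]_x (f x)%:E = \int[m2]_x (f x)%:E)%E ->
  forall A, measurable A -> m1 A = m2 A.
Proof.
move=> eqf; apply: (@measure_unique _ _ L (@open 'cV[K]_d) (fun=> setT)).
- by [].
- by move=> A B; exact: openI.
- by move=> _; exact: openT.
- by apply/seteqP; split=> // x _; exists 0%N.
- move=> U oU; have [UT|/set0P nUT] := eqVneq (~` U) set0.
    have -> : U = [set: L] by rewrite -[U]setCK UT setC0.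
    exact: etrans (probability_setT m1) (esym (probability_setT m2)).
  pose D := dist_to (~` U).
  have D0 x : 0 <= D x by exact: dist_to_ge0.
  have cD : continuous D by exact: dist_to_continuous.
  pose f (k : nat) (x : 'cV[K]_d) := Num.min 1 (k%:R * D x).
  have f01 k x : 0 <= f k x <= 1.
    by rewrite le_min ler01 ge_min lexx andbT mulr_ge0.
  have cf k : continuous (f k).
    move=> x; apply: (@continuous_min _ _ (cst 1) (fun x => k%:R * D x) x).
      exact: cst_continuous.
    by apply: (@cvgM _ _ _ (nbhs_filter x)); [exact: cvg_cst|exact: cD].
  have mf k : measurable_fun setT (f k : L -> R).
    apply: measurable_fun_sublevel_closed => r.
    have /continuous_closedP cl := cf k.
    by apply: (cl [set t | t <= r]); exact: closed_le.
  have limf x : limn (fun k => (f k x)%:E) = (\1_U x)%:E.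
    apply/cvg_lim => //; apply: cvg_near_cst; rewrite indicE.
    case: (boolP (x \in U)) => [/set_mem Ux|/negP xU].
      have Dx : 0 < D x by apply: dist_to_gt0 => //; rewrite ?closedC// => /(_ Ux).
      exists (Num.truncn (D x)^-1).+1 => // k /= kD; congr EFin; apply/min_idPl.
      rewrite -ler_pdivrMr// mul1r (le_trans (ltW (truncnS_gt _)))// ler_nat//.
    exists 0%N => // k _; congr EFin; rewrite /f /D (dist_to_mem nUT) ?mulr0.
      by apply/min_idPr; exact: ler01.
    by move=> /mem_set.
  have key (m : probability L R) : m U = limn (fun k => \int[m]_x (f k x)%:E)%E.
    rewrite -monotone_convergence//=; last 3 first.
    - by move=> k; apply/measurable_EFinP; exact: mf.
    - by move=> k x _; rewrite lee_fin; have /andP[] := f01 k x.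
    - move=> x _ i j ij; rewrite lee_fin le_min ge_min lexx/= ge_min.
      by rewrite orbC ler_wpM2r// ler_nat.
    under eq_integral do rewrite limf.
    by rewrite integral_indic// ?setIT//; exact: borel_open_measurable.
  apply: etrans (key m1) (esym (etrans (key m2) _)).
  by congr (limn _); apply/funext => k; exact/esym/eqf.
- by move=> _; rewrite (le_lt_trans (probability_le1 m1 measurableT))// ltry.
Qed.

Lemma stationary_invariant_law (hK : local_field K)
    (mu : probability (borel (affinity K d)) R) (nu : probability L R) :
  stationary mu nu -> invariant_law mu id nu.
Proof.
move=> hstat.
have msw : measurable_fun setT
    (fun p : L * borel (affinity K d) => affinity_apply p.2 p.1 : L).
  exact: measurableT_comp (measurable_affinity_apply hK) (@measurable_swap _ _ _ _).
have eqm A : measurable A -> random_image nu mu msw A = nu A.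
  apply: eq_probability_continuous A => f cf f01.
  rewrite random_imageE; last 2 first.
  - apply/measurable_EFinP; apply: measurable_fun_sublevel_closed => r.
    have /continuous_closedP cl := cf.
    by apply: (cl [set t | t <= r]); exact: closed_le.
  - by move=> x; rewrite lee_fin; have /andP[] := f01 x.
  apply: hstat => //; exists 1 => x.
  by have /andP[f0 f1] := f01 x; rewrite ger0_norm.
move=> F mF F0; rewrite -(random_image_swapE nu mu msw mF F0).
by apply: eq_measure_integral => A mA _; exact: eqm.
Qed.

End stationary.

(** * Convolution powers *)

Section block_law.
Context (R : realType) (K : absvFieldType R) (d : nat).
Hypothesis hK : local_field K.
Notation G := (borel (affinity K d)).
Notation L := (borel 'cV[K]_d).

Lemma measurable_block n :
  measurable_fun setT (fun t : n.-tuple G => seq_affinity id t : G).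
Proof. by apply: measurable_seq_affinity => //; exact: measurable_id. Qed.

(** The n-th convolution power of m. *)
Definition block_law (m : probability G R) n : probability G R :=
  distribution (iid_law m n) (mfun_Sub (mem_set (measurable_block (n := n)))).

Lemma block_lawE (m : probability G R) n (F : G -> \bar R) :
  measurable_fun setT F -> (forall g, 0 <= F g)%E ->
  (\int[block_law m n]_g F g = \int[iid_law m n]_t F (seq_affinity id t))%E.
Proof. by move=> mF F0; rewrite ge0_integral_distribution. Qed.

Lemma invariant_block (m : probability G R) n nu :
  invariant_law m id nu -> invariant_law (block_law m n) id nu.
Proof.
move=> inv F mF F0; rewrite block_lawE.
- by apply: (@invariant_law_tuple _ _ hK _ _ G m id nu n _ inv F mF F0);
    exact: measurable_id.
- apply: (measurable_mean_apply hK) => //; exact: measurable_id.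
- by move=> g; apply: integral_ge0 => x _; exact: F0.
Qed.

Lemma log_size_block (m : probability G R) n :
  (\int[m]_g (log_size g)%:E < +oo ->
   \int[block_law m n]_g (log_size g)%:E < +oo)%E.
Proof.
move=> mlt; have ml := @measurable_log_size R K d.
rewrite block_lawE; last 2 first.
- exact/measurable_EFinP.
- by move=> g; rewrite lee_fin log_size_ge0.
apply: (@le_lt_trans _ _ (\int[iid_law m n]_t (\sum_(s <- t) log_size s)%:E)%E).
  apply: ge0_le_integral => //.
  - by move=> t _; rewrite lee_fin log_size_ge0.
  - by apply/measurable_EFinP; exact: measurableT_comp ml (measurable_block (n := n)).
  - by apply/measurable_EFinP; exact: measurable_sum_tuple.
  - by move=> t _; rewrite lee_fin log_size_seq.
rewrite integral_iid_sum//; last by move=> g; exact: log_size_ge0.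
by rewrite lte_mul_pinfty// lee_fin.
Qed.

Lemma measurable_ln_opnorm :
  measurable_fun setT (fun g : G => ln (opnorm (linear_part g))).
Proof. exact: measurableT_comp (@measurable_ln R) (@measurable_opnorm_linear R K d). Qed.

Hypothesis d0 : (0 < d)%N.

Lemma integrable_ln_opnorm (m : probability G R) :
  (\int[m]_g (log_size g)%:E < +oo)%E ->
  m.-integrable setT (fun g => (ln (opnorm (linear_part g)))%:E).
Proof.
move=> mlt; apply/integrableP; split.
  by apply/measurable_EFinP; exact: measurable_ln_opnorm.
apply: le_lt_trans mlt; apply: ge0_le_integral => //.
- by apply: measurableT_comp => //; apply/measurable_EFinP; exact: measurable_ln_opnorm.
- by apply/measurable_EFinP; exact: measurable_log_size.
- by move=> g _; rewrite lee_fin abs_ln_opnorm_le.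
Qed.

Lemma integral_block_ln_opnorm (m : probability G R) n :
  (\int[m]_g (log_size g)%:E < +oo)%E ->
  (\int[block_law m n]_g (ln (opnorm (linear_part g)))%:E =
   \int[iid_law m n]_t (ln (opnorm (linear_part (seq_affinity id t))))%:E)%E.
Proof.
move=> mlt; rewrite integral_distribution//.
  by apply/measurable_EFinP; exact: measurable_ln_opnorm.
apply/integrableP; split.
  apply/measurable_EFinP.
  exact: measurableT_comp measurable_ln_opnorm (measurable_block (n := n)).
apply: le_lt_trans (log_size_block n mlt).
rewrite block_lawE; last 2 first.
- by apply/measurable_EFinP; exact: measurable_log_size.
- by move=> g; rewrite lee_fin log_size_ge0.
apply: ge0_le_integral => //.
- apply: measurableT_comp => //; apply/measurable_EFinP.
  exact: measurableT_comp measurable_ln_opnorm (measurable_block (n := n)).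
- apply/measurable_EFinP.
  exact: measurableT_comp (@measurable_log_size R K d) (measurable_block (n := n)).
- by move=> g _; rewrite lee_fin abs_ln_opnorm_le.
Qed.

Lemma linear_part_block n (t : n.-tuple (affinity K d)) :
  linear_part (seq_affinity id t) = linear_prod t.
Proof.
rewrite /linear_prod /seq_affinity.
have -> : 1%:M = linear_part (affinity1 K d) by [].
by elim: (tval t) (affinity1 K d) => //= s u ih g; rewrite ih.
Qed.

Lemma measurable_opnorm_ge (r : R) :
  measurable [set g : G | (r <= opnorm (linear_part g))%R].
Proof. exact: measurable_superlevel (@measurable_opnorm_linear R K d). Qed.

Lemma log_size_moment (mu : probability G R) :
  moment_of_order_one mu -> (\int[mu]_g (log_size g)%:E < +oo)%E.
Proof.
move=> [mom1 mom2].
have m1 : measurable_fun setT (fun g : G => log_plus (opnorm (affinity_mx g))).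
  apply: measurableT_comp; first exact: measurable_log_plus.
  exact: measurable_opnorm (@affinity_mx_continuous R K d).
have m2 : measurable_fun setT (fun g : G => log_plus (opnorm (invmx (affinity_mx g)))).
  apply: measurableT_comp; first exact: measurable_log_plus.
  exact: measurable_opnorm_inv (@affinity_mx_continuous R K d) (@affinity_mx_unit R K d).
apply: (@le_lt_trans _ _ (\int[mu]_g ((log_plus (opnorm (affinity_mx g)))%:E +
    (log_plus (opnorm (invmx (affinity_mx g))))%:E))%E).
  apply: ge0_le_integral => //.
  - by move=> g _; rewrite lee_fin log_size_ge0.
  - by apply/measurable_EFinP; exact: measurable_log_size.
  - by apply/measurable_EFinP; exact: measurable_funD.
  - by move=> g _; rewrite -EFinD lee_fin log_size_le.
rewrite ge0_integralD//.
- exact: (lte_add_pinfty mom1 mom2).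
- by move=> g _; rewrite lee_fin log_plus_ge0.
- exact/measurable_EFinP.
- by move=> g _; rewrite lee_fin log_plus_ge0.
- exact/measurable_EFinP.
Qed.

(** A negative Lyapunov exponent gives some n for which the product of n factors
    has a negative mean logarithmic norm; products of many independent such
    blocks then contract with probability close to 1. *)
Lemma contracting_block (mu : probability G R) nu (r e : R) :
  moment_of_order_one mu -> (lyapunov_exponent mu < 0)%E ->
  invariant_law mu id nu -> 0 < r -> 0 < e ->
  exists m : probability G R, [/\ invariant_law m id nu,
    (\int[m]_g (log_size g)%:E < +oo)%E &
    (m [set g | (r <= opnorm (linear_part g))%R] <= e%:E)%E].
Proof.
move=> mom hl inv r0 e0; have mlt := log_size_moment mom.
have [n n0] : exists n, (\int[iid_law mu n]_t (ln (opnorm (linear_prod t)))%:E < 0)%E.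
  (* A divergent sequence has limit 0 by convention, so it cannot have a negative
     one. *)
  apply: contrapT => /forallNP nneg; move: hl; apply/negP; rewrite -leNgt.
  have u0 k : (0 <= (k%:R^-1)%:E *
      \int[iid_law mu k]_t (ln (opnorm (linear_prod t)))%:E)%E.
    by rewrite mule_ge0 ?lee_fin// leNgt; apply/negP; exact: nneg.
  rewrite /lyapunov_exponent; set u := fun k : nat => _.
  have [cu|ncu] := pselect (cvg (u @ \oo)).
    by apply: lime_ge => //; apply: nearW => k; exact: u0.
  rewrite (_ : limn u = 0%E)//; apply: xgetPN => l ul; apply: ncu.
  by apply/cvg_ex; exists l.
pose m1 := block_law mu n.
have m1lt : (\int[m1]_g (log_size g)%:E < +oo)%E by exact: log_size_block.
have m10 : (\int[m1]_g (ln (opnorm (linear_part g)))%:E < 0)%E.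
  have E : (\int[m1]_g (ln (opnorm (linear_part g)))%:E =
      \int[iid_law mu n]_t (ln (opnorm (linear_prod t)))%:E)%E.
    apply: etrans (integral_block_ln_opnorm n mlt) _.
    by apply: eq_integral => t _; rewrite linear_part_block.
  by rewrite E.
have [k kP] := contraction_in_probability d0 (integrable_ln_opnorm m1lt) m10 r0 e0.
exists (block_law m1 k); split.
- by do 2 apply: invariant_block.
- exact: log_size_block.
- apply: kP => //.
  rewrite -[X in measurable X]setTI; apply: (measurable_block (n := k)) => //.
  exact: measurable_opnorm_ge.
Qed.

End block_law.

(** * Absence of atoms *)

Section atoms.
Context (R : realType) (K : absvFieldType R) (d : nat).
Notation G := (borel (affinity K d)).
Notation L := (borel 'cV[K]_d).
Variable nu : probability L R.
Implicit Types x y : L.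

Lemma measurable_point x : measurable ([set x] : set L).
Proof.
have cx : closed ([set x] : set 'cV[K]_d).
  by apply/accessible_closed_set1/hausdorff_accessible; exact: metric_hausdorff.
rewrite -[[set x]]setCK; apply: measurableC; apply: borel_open_measurable.
by rewrite openC.
Qed.

Definition atom_mass x : R := fine (nu [set x]).

Lemma atom_massE x : nu [set x] = (atom_mass x)%:E.
Proof.
by rewrite /atom_mass fineK//; apply: fin_num_measure; exact: measurable_point.
Qed.

Lemma atom_mass_ge0 x : 0 <= atom_mass x.
Proof. by rewrite -lee_fin -atom_massE. Qed.

(** Otherwise there is a sequence of atoms of increasing masses, of infinite
    total mass. *)
Lemma exists_max_atom x0 : 0 < atom_mass x0 ->
  exists2 x, 0 < atom_mass x & forall y, atom_mass y <= atom_mass x.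
Proof.
move=> x00; apply: contrapT => nomax.
have nxt (p : {x | 0 < atom_mass x}) :
    exists q : {x | 0 < atom_mass x}, atom_mass (sval p) < atom_mass (sval q).
  case: p => x x0' /=; apply: contrapT => nq; apply: nomax; exists x => // y.
  rewrite leNgt; apply/negP => xy; apply: nq.
  by exists (exist _ y (lt_trans x0' xy)).
have [f fP] := choice nxt.
pose u n := sval (iter n f (exist _ x0 x00)).
have uS n : atom_mass (u n) < atom_mass (u n.+1) by exact: fP.
have umono i j : (i < j)%N -> atom_mass (u i) < atom_mass (u j).
  have tr : transitive (fun a b : R => a < b) by move=> ? ? ?; exact: lt_trans.
  exact: (@homo_ltn _ (atom_mass \o u) _ tr uS).
have ux0 n : atom_mass x0 <= atom_mass (u n).
  by elim: n => // n ih; rewrite (le_trans ih)// ltW.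
have tU : trivIset setT (fun n => [set u n] : set L).
  move=> i j _ _ [y [/= -> ij]]; apply/eqP; case: (ltgtP i j) => // h.
    by have := umono _ _ h; rewrite ij ltxx.
  by have := umono _ _ h; rewrite ij ltxx.
pose n := (Num.truncn (atom_mass x0)^-1).+1.
have := measure_bigsetU nu (fun k => measurable_point (u k)) tU n.
apply/eqP; rewrite lt_eqF//.
apply: (@le_lt_trans _ _ 1%E).
  by apply: probability_le1; apply: bigsetU_measurable => k _; exact: measurable_point.
apply: (@lt_le_trans _ _ (\sum_(k < n) (atom_mass x0)%:E)%E).
  rewrite sumEFin lte_fin sumr_const card_ord -mulr_natl -ltr_pdivrMr// mul1r.
  exact: truncnS_gt.
by apply: lee_sum => k _; rewrite [leRHS]atom_massE lee_fin.
Qed.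

Lemma probability_far (e : R) : 0 < e ->
  exists k : nat, (nu [set x | (k%:R <= vnorm x)%R] <= e%:E)%E.
Proof.
move=> e0; apply: exists_measure_le e0 => [k|i j ij x /=|].
- exact: measurable_superlevel (@measurable_vnorm R K d).
- by apply: le_trans; rewrite ler_nat.
rewrite (_ : \bigcap_k _ = set0) ?measure0//.
apply/seteqP; split=> // x /= /(_ (Num.truncn (vnorm x)).+1 I) /=.
by rewrite leNgt truncnS_gt.
Qed.

Lemma affinity_fiber g (x : L) :
  (fun y : L => affinity_apply g y : L) @^-1` [set x] =
  [set invmx (linear_part g) *m (x - translation g)].
Proof.
have u := linear_part_unit g.
apply/seteqP; split=> y /=; rewrite /affinity_apply.
  by move=> <-; rewrite addrK mulKmx.
by move=> ->; rewrite mulKVmx// subrK.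
Qed.

Hypothesis hK : local_field K.

(** The mass of x is the mean of the masses of its preimages, none of which
    exceeds it. *)
Lemma ae_max_atom (m : probability G R) x : invariant_law m id nu ->
  (forall y, atom_mass y <= atom_mass x) ->
  {ae m, forall g, atom_mass (invmx (linear_part g) *m (x - translation g)) = atom_mass x}.
Proof.
move=> inv xmax.
pose phi (g : G) := atom_mass (invmx (linear_part g) *m (x - translation g)).
have mI : measurable_fun setT (fun y : L => (\1_[set x] y)%:E : \bar R).
  by apply/measurable_EFinP; apply: measurable_indic; exact: measurable_point.
have I0 y : (0 <= (\1_[set x] y)%:E :> \bar R)%E by rewrite lee_fin.
have phiE g : (\int[nu]_y (\1_[set x] (affinity_apply g y))%:E)%E = (phi g)%:E.
  rewrite -[RHS]atom_massE -affinity_fiber.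
  rewrite -[X in nu X]setIT -integral_indic//.
  by rewrite affinity_fiber; exact: measurable_point.
have mphi : measurable_fun setT phi.
  apply/measurable_EFinP.
  have := measurable_mean_apply hK (@measurable_id _ G setT) nu mI I0.
  by under eq_fun do rewrite phiE.
have int_phi : (\int[m]_g (phi g)%:E = (atom_mass x)%:E)%E.
  under eq_integral do rewrite -phiE.
  apply: etrans (inv _ mI I0) _.
  by rewrite (integral_indic nu measurableT (measurable_point x)) setIT; exact: atom_massE.
have i_phi : m.-integrable setT (EFin \o phi).
  apply/integrableP; split; first exact/measurable_EFinP.
  rewrite (eq_integral (EFin \o phi)); first by rewrite int_phi ltry.
  by move=> g _ /=; rewrite ger0_norm// atom_mass_ge0.
have : (\int[m]_g `|(atom_mass x - phi g)%:E|)%E = 0%E.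
  rewrite (eq_integral (fun g => (atom_mass x)%:E - (phi g)%:E)%E); last first.
    move=> g _; have h : 0 <= atom_mass x - phi g by rewrite subr_ge0; exact: xmax.
    by rewrite -EFinB gee0_abs ?lee_fin.
  have iC : m.-integrable setT (EFin \o cst (atom_mass x)).
    exact: finite_measure_integrable_cst.
  rewrite (integralB measurableT iC i_phi).
  rewrite int_phi (eq_integral (cst (atom_mass x)%:E))// integral_cst//.
  by rewrite [X in (_ * X)%E]probability_setT mule1 subee.
move=> /(ae_eq_integral_abs m measurableT) => /(_ _)[].
  by apply/measurable_EFinP; exact: measurable_funB.
move=> N [mN N0 sN]; exists N; split=> // g /= ng; apply: sN => /= ng'.
apply: ng; have := ng' I => -[] /eqP.
by rewrite subr_eq0 eq_sym => /eqP.
Qed.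

(** Two such atoms have, under almost every affinity, two preimages of the same
    mass, and all these points lie in a fixed ball; an affinity with a small
    linear part would bring the images of the preimages, which are the two given
    atoms, too close together. *)
Lemma max_atom_unique (x y : L) : 0 < atom_mass x ->
  (forall z, atom_mass z <= atom_mass x) -> atom_mass y = atom_mass x ->
  (forall r, 0 < r -> exists2 m : probability G R, invariant_law m id nu &
    (m [set g | (r <= opnorm (linear_part g))%R] <= (2^-1)%:E)%E) ->
  y = x.
Proof.
move=> x0 xmax yx contr; apply/eqP; apply: contrapT => /negP yNx.
have [k kP] := probability_far (divr_gt0 x0 (ltr0Sn R 1)).
have bounded z : atom_mass z = atom_mass x -> vnorm z < k%:R.
  move=> zx; rewrite ltNge; apply/negP => kz.
  have : (nu [set z] <= (atom_mass x / 2)%:E)%E.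
    apply: le_trans kP; apply: le_measure; rewrite ?inE.
    - exact: measurable_point.
    - exact: measurable_superlevel (@measurable_vnorm R K d).
    - by move=> _ ->.
  by rewrite atom_massE lee_fin zx; lra.
have xy0 : 0 < vnorm (y - x) by rewrite vnorm_gt0// subr_eq0.
have k0 : 0 < k%:R :> R by rewrite (le_lt_trans (vnorm_ge0 x)) ?bounded.
have r0 : 0 < vnorm (y - x) / (2 * k%:R) by rewrite divr_gt0// mulr_gt0.
have [m inv mr] := contr _ r0.
have ymax z : atom_mass z <= atom_mass y by rewrite yx.
have [N [mN N0 NP]] := ae_max_atom inv xmax.
have [N' [mN' N0' NP']] := ae_max_atom inv ymax.
set A := [set g : G | _] in mr.
have mA : measurable A by exact: measurable_opnorm_ge.
have [g gP] : ~` (A `|` (N `|` N')) !=set0.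
  apply/set0P/negP => /eqP E.
  have : (m (A `|` (N `|` N')) <= (2^-1)%:E)%E.
    apply: (le_trans (measureU2 _ _ _)) => //; first exact: measurableU.
    rewrite -[leRHS]adde0 leeD// (le_trans (measureU2 _ _ _))//.
    by rewrite [X in (X + _)%E]N0 [X in (_ + X)%E]N0' adde0.
  rewrite -[_ `|` _]setCK E setC0 [X in (X <= _)%E]probability_setT lee_fin; lra.
move: gP => /not_orP[gA /not_orP[gN gN']].
have {}gN : atom_mass (invmx (linear_part g) *m (x - translation g)) = atom_mass x.
  by apply: contrapT => ?; apply/gN/NP.
have {}gN' : atom_mass (invmx (linear_part g) *m (y - translation g)) = atom_mass y.
  by apply: contrapT => ?; apply/gN'/NP'.
set u := invmx _ *m _ in gN; set v := invmx _ *m _ in gN'.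
have yxE : y - x = linear_part g *m (v - u).
  by rewrite mulmxBr !mulKVmx ?linear_part_unit// opprB addrA subrK.
apply: gA; rewrite /A /= ler_pdivrMr ?mulr_gt0// {1}yxE.
rewrite (le_trans (opnormP _ _))// ler_wpM2l ?opnorm_ge0//.
rewrite (le_trans (vnormD _ _))// vnormN mulrDl mul1r.
by rewrite lerD// ltW// bounded// gN' yx.
Qed.

(** A unique atom of maximal mass is fixed by almost every affinity, hence by
    those in the support: it is a proper invariant affine subspace. *)
Lemma atomless (mu : probability G R) : (0 < d)%N -> invariant_law mu id nu ->
  (forall r, 0 < r -> exists2 m : probability G R, invariant_law m id nu &
    (m [set g | (r <= opnorm (linear_part g))%R] <= (2^-1)%:E)%E) ->
  (forall M : set 'cV[K]_d, affine_subspace M -> M <> [set: 'cV[K]_d] ->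
    ~ (forall g : affinity K d, msupport mu g -> fixes g M)) ->
  forall x, nu [set x] = 0%E.
Proof.
move=> d0 inv contr hfix z; apply/eqP; rewrite atom_massE; apply: contrapT => /negP z0.
have {}z0 : 0 < atom_mass z by rewrite lt_neqAle atom_mass_ge0 andbT eq_sym.
have [x x0 xmax] := exists_max_atom z0.
apply: (hfix [set x]).
- exists x, 0%VS; apply/seteqP; split=> y /=; first by move->; rewrite subrr mem0v.
  by rewrite memv0 subr_eq0 => /eqP.
- move=> xT; have : [set x] (x + const_mx 1) by rewrite xT.
  move=> /= /eqP; rewrite addrC -subr_eq0 addrK => /eqP /colP /(_ (Ordinal d0)).
  by rewrite !mxE => /eqP; rewrite oner_eq0.
move=> g gsupp; suff gx : affinity_apply g x = x.
  apply/seteqP; split=> [_ [y /= -> <-]//|_ /= ->]; by exists x.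
apply: contrapT => gx.
pose U := [set h : affinity K d | affinity_apply h x <> x].
have oU : open U.
  have cx : closed ([set x] : set 'cV[K]_d).
    by apply/accessible_closed_set1/hausdorff_accessible; exact: metric_hausdorff.
  have cE : continuous (fun h : affinity K d => affinity_apply h x).
    move=> h; apply: (@absv_cvg_addmx _ _ _ _ (nbhs_filter h)).
      apply: (@absv_cvg_mulmx _ _ _ _ (nbhs_filter h)); last exact: cvg_cst.
      exact: linear_part_continuous.
    exact: translation_continuous.
  have /continuousP cP := cE.
  by apply: (cP (~` [set x])); rewrite openC.
have := gsupp U oU gx; apply/negP; rewrite -leNgt.
have [N [mN N0 NP]] := ae_max_atom inv xmax.
rewrite -N0; apply: le_measure; rewrite ?inE//; first exact: borel_open_measurable.
move=> h hx; apply: NP => /= /(max_atom_unique x0 xmax) /(_ contr) E.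
by apply: hx; rewrite -{1}E /affinity_apply mulKVmx ?linear_part_unit// subrK.
Qed.

Lemma measurable_vnormB :
  measurable_fun setT (fun p : L * L => vnorm (p.1 - p.2 : 'cV[K]_d)).
Proof.
have mB : measurable_fun setT (fun p : L * L => p.1 - p.2 : L).
  apply: continuous_prod_measurable; [exact: matrix_second_countable|
    exact: matrix_second_countable|move=> p].
  rewrite (_ : (fun _ => _) = fun q : 'cV[K]_d * 'cV[K]_d => q.1 + (-1)%:M *m q.2).
    apply: absv_cvg_addmx; first exact: cvg_fst.
    by apply: absv_cvg_mulmx; [exact: cvg_cst|exact: cvg_snd].
  by apply/funext => q; rewrite mul_scalar_mx scaleN1r.
exact: measurableT_comp (@measurable_vnorm R K d) mB.
Qed.

Lemma measurable_image0_ball (b : L) (r : R) :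
  measurable [set g : G | vnorm (affinity_apply g 0 - b : 'cV[K]_d) <= r].
Proof.
have m0 := measurable_fun_pair1 (0 : L) (measurable_affinity_apply hK (d := d)).
have mgb : measurable_fun setT (fun g : G => (affinity_apply g 0 : L, b)).
  by apply: measurable_fun_pair => //; exact: m0.
have mv : measurable_fun setT
    (fun g : G => vnorm (affinity_apply g 0 - b : 'cV[K]_d)).
  exact: measurableT_comp measurable_vnormB mgb.
exact: (measurable_sublevel r mv).
Qed.

Lemma measurable_cball (b : L) (r : R) :
  measurable [set x : L | vnorm (x - b : 'cV[K]_d) <= r].
Proof. exact: measurable_sublevel (measurable_fun_pair1 b measurable_vnormB). Qed.

(** For B of diameter at most r, the square of the mass of B is at most the mass
    for nu x nu of the r-neighborhood of the diagonal, which tends to 0 with r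
    as the diagonal has mass 0. *)
Lemma uniform_small_balls (e : R) : (forall x, nu [set x] = 0%E) -> 0 < e ->
  exists2 r : R, 0 < r &
    forall b : L, (nu [set x : L | (vnorm (x - b : 'cV[K]_d) <= r)%R] <= e%:E)%E.
Proof.
move=> nu0 e0.
have mball (r : R) : measurable [set p : L * L | vnorm (p.1 - p.2 : 'cV[K]_d) <= r].
  exact: measurable_sublevel measurable_vnormB.
pose A (k : nat) := [set p : L * L | vnorm (p.1 - p.2 : 'cV[K]_d) <= k.+1%:R^-1].
have e20 : 0 < e ^+ 2 by rewrite exprn_gt0.
have ndA : {homo A : n m / (n <= m)%N >-> m `<=` n}.
  by move=> i j ij p /=; move/le_trans; apply; rewrite lef_pV2 ?posrE// ler_nat.
have capA : ((nu \x nu) (\bigcap_k A k) = 0)%E.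
  rewrite /product_measure1 /=; apply: integral0_eq => x _ /=.
  rewrite -(nu0 x); congr (nu _); apply/seteqP; split=> y /=; last first.
    move=> -> ; rewrite /xsection /= inE => k _ /=.
    by rewrite /A /= subrr vnorm0.
  rewrite /xsection /= inE => xy; apply/eqP; rewrite eq_sym -subr_eq0.
  apply: contrapT => /negP /vnorm_gt0 v0.
  have [k] := @ltr_add_invr R 0 _ v0; rewrite add0r ltNge => /negP; apply.
  exact: (xy k I).
have [k Ak] := @exists_measure_le _ _ _ (nu \x nu)%E A _ (fun k => mball _) ndA capA e20.
exists (k.+1%:R^-1 / 2) => [|b]; first by rewrite divr_gt0.
set B := [set x : L | _].
have mB : measurable B by exact: measurable_cball.
have BA : B `*` B `<=` A k.
  move=> [x y] [/= Bx By]; rewrite /A /= -[x](subrK b) -addrA.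
  rewrite (le_trans (vnormD _ _))// [leRHS]splitr lerD//.
  by rewrite -vnormN opprB.
have BB : (nu B * nu B <= (e ^+ 2)%:E)%E.
  have <- : ((nu \x nu) (B `*` B) = nu B * nu B)%E by exact: product_measure1E.
  apply: le_trans Ak; apply: le_measure => //; rewrite inE.
    exact: measurableX.
  exact: mball.
have [v vE] : exists v, nu B = v%:E.
  by exists (fine (nu B)); rewrite fineK//; exact: fin_num_measure.
have v0 : 0 <= v by rewrite -lee_fin -vE.
have : (v%:E * v%:E <= (e ^+ 2)%:E)%E by rewrite -vE; exact: BB.
rewrite -EFinM lee_fin -expr2 => ve.
suff : (v%:E <= e%:E)%E by rewrite -vE.
by rewrite lee_fin -(@ler_pXn2r _ 2) ?nnegrE// ltW.
Qed.

End atoms.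

(** * The walk that records the cost of expansion *)

Section chain.
Context (R : realType) (K : absvFieldType R) (d : nat).
Hypothesis hK : local_field K.
Notation G := (borel (affinity K d)).
Notation L := (borel 'cV[K]_d).
Variables (m : probability G R) (nu : probability L R) (delta B : R).
Hypothesis inv : invariant_law m id nu.
Hypotheses (delta0 : 0 < delta) (B0 : 0 < B).

(** A step that is not expanding sends z within delta of the image of 0. *)
Definition expanding : set (G * L) :=
  [set p | (delta < vnorm (linear_part p.1 *m p.2))%R].

Definition cost (p : G * L) : R := 2 * \1_expanding p + B * log_size p.1.

Lemma measurable_expanding : measurable expanding.
Proof.
have mv := measurableT_comp (@measurable_vnorm R K d) (measurable_linear_action hK (d := d)).
rewrite (_ : expanding = ~` [set p | vnorm (linear_part p.1 *m p.2) <= delta]).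
  by apply: measurableC; exact: measurable_sublevel mv.
by apply/seteqP; split=> p /=; rewrite /expanding /= ltNge => /negP.
Qed.

Lemma measurable_cost : measurable_fun setT cost.
Proof.
apply: measurable_funD; apply: measurable_funM => //.
  by apply: measurable_indic; exact: measurable_expanding.
exact: measurableT_comp (@measurable_log_size R K d) measurable_fst.
Qed.

Lemma cost_ge0 p : 0 <= cost p.
Proof. by rewrite addr_ge0// mulr_ge0// ?(ltW B0)// log_size_ge0. Qed.

(** After n steps from (z, 0) the second coordinate is the maximum over k of the
    cost of the last k steps minus k (a Lindley recursion). *)
Definition walk (q : (L * R) * G) : L * R :=
  (affinity_apply q.2 q.1.1, Num.max 0 (q.1.2 + cost (q.2, q.1.1) - 1)).

Lemma measurable_walk : measurable_fun setT walk.
Proof.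
have msw : measurable_fun setT (fun q : (L * R) * G => (q.2, q.1.1)).
  apply: measurable_fun_pair => //=.
  exact: measurableT_comp measurable_fst measurable_fst.
apply: measurable_fun_pair => /=.
  exact: measurableT_comp (measurable_affinity_apply hK (d := d)) msw.
apply: measurable_maxr => //; apply: measurable_funB => //.
apply: measurable_funD.
  exact: measurableT_comp measurable_snd measurable_fst.
exact: measurableT_comp measurable_cost msw.
Qed.

Let start (z : L) : L * R := (z, 0).

Let measurable_start : measurable_fun setT start.
Proof. by apply: measurable_fun_pair. Qed.

Fixpoint chain n : probability (L * R)%type R :=
  if n is k.+1 then random_image (chain k) m measurable_walk
  else distribution nu (mfun_Sub (mem_set measurable_start)).

Local Open Scope ereal_scope.
Implicit Types F : L * R -> \bar R.

Lemma chain0E F : measurable_fun setT F -> (forall p, 0 <= F p) ->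
  \int[chain 0]_p F p = \int[nu]_z F (z, 0%R).
Proof. by move=> mF F0; rewrite ge0_integral_distribution. Qed.

Definition mean_walk F p := \int[m]_g F (walk (p, g)).

Lemma measurable_mean_walk F : measurable_fun setT F -> (forall p, 0 <= F p) ->
  measurable_fun setT (mean_walk F).
Proof.
move=> mF F0.
apply: (@measurable_fun_fubini_tonelli_F _ _ _ _ _ m (fun q => F (walk q))) => //.
exact: (measurableT_comp mF measurable_walk).
Qed.

Lemma mean_walk_ge0 F p : (forall p, 0 <= F p) -> 0 <= mean_walk F p.
Proof. by move=> F0; apply: integral_ge0. Qed.

Lemma chainSE n F : measurable_fun setT F -> (forall p, 0 <= F p) ->
  \int[chain n.+1]_p F p = \int[chain n]_p mean_walk F p.
Proof. exact: random_imageE. Qed.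

Lemma chain_fst n (f : L -> \bar R) : measurable_fun setT f ->
  (forall z, 0 <= f z) -> \int[chain n]_p f p.1 = \int[nu]_z f z.
Proof.
elim: n f => [|n ih] f mf f0.
  by rewrite chain0E//; exact: measurableT_comp mf measurable_fst.
rewrite chainSE//; last exact: measurableT_comp mf measurable_fst.
pose h (z : L) := \int[m]_g f (affinity_apply g z).
have mfa : measurable_fun setT (fun p : G * L => f (affinity_apply p.1 p.2)).
  exact: measurableT_comp mf (measurable_affinity_apply hK (d := d)).
have mh : measurable_fun setT h.
  exact: (@measurable_fun_fubini_tonelli_G _ _ _ _ _ m _ mfa (fun p => f0 _)).
have h0 z : 0 <= h z by apply: integral_ge0.
apply: etrans (ih h mh h0) _.
apply: etrans (inv mf f0); apply/esym.
exact: (@fubini_tonelli _ _ _ _ _ m nu _ mfa (fun p => f0 _)).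
Qed.

Lemma walk_homo z g (w w' : R) : (w <= w')%R ->
  ((walk ((z, w), g)).2 <= (walk ((z, w'), g)).2)%R.
Proof. by move=> ww; rewrite /walk /= le_max2// lerB// lerD. Qed.

(** Adding a step at the beginning of a trajectory replaces the initial pair
    (z, 0) by one with a larger second coordinate and a first one of the same
    law. *)
Lemma chain_homo n F : measurable_fun setT F -> (forall p, 0 <= F p) ->
  (forall z w w', (w <= w')%R -> F (z, w) <= F (z, w')) ->
  \int[chain n]_p F p <= \int[chain n.+1]_p F p.
Proof.
elim: n F => [|n ih] F mF F0 Fmono.
  have mF0 : measurable_fun setT (fun z : L => F (z, 0%R)).
    exact: measurableT_comp mF measurable_start.
  rewrite (chainSE 0 mF F0) (chain0E mF F0) chain0E; last 2 first.
  - exact: measurable_mean_walk.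
  - by move=> p; exact: mean_walk_ge0.
  have mq : measurable_fun setT (fun q : L * G => F (walk ((q.1, 0%R), q.2))).
    have mp : measurable_fun setT (fun q : L * G => ((q.1, 0%R : R), q.2)).
      by apply: measurable_fun_pair => //; exact: measurable_fun_pair.
    exact: measurableT_comp mF (measurableT_comp measurable_walk mp).
  have mz : measurable_fun setT
      (fun q : G * L => F ((affinity_apply q.1 q.2 : L), 0%R)).
    exact: measurableT_comp mF0 (measurable_affinity_apply hK (d := d)).
  have -> : \int[nu]_z F (z, 0%R) =
      \int[m]_g \int[nu]_z F ((affinity_apply g z : L), 0%R).
    exact/esym/(inv mF0 (fun z => F0 _)).
  have -> : \int[nu]_z mean_walk F (z, 0%R) =
      \int[m]_g \int[nu]_z F (walk ((z, 0%R), g)).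
    exact: (@fubini_tonelli _ _ _ _ _ nu m _ mq (fun p => F0 _)).
  apply: ge0_le_integral => //.
  - by move=> g _; apply: integral_ge0.
  - exact: (@measurable_fun_fubini_tonelli_F _ _ _ _ _ nu _ mz (fun p => F0 _)).
  - exact: (@measurable_fun_fubini_tonelli_G _ _ _ _ _ nu _ mq (fun p => F0 _)).
  move=> g _; apply: ge0_le_integral => //.
  - exact: (measurable_fun_pair2 g mz).
  - exact: (measurable_fun_pair1 g mq).
  by move=> z _; apply: Fmono; rewrite le_max lexx.
rewrite (chainSE n)// (chainSE n.+1)//; apply: ih.
- exact: measurable_mean_walk.
- by move=> p; exact: mean_walk_ge0.
move=> z w w' ww; apply: ge0_le_integral => //.
- exact: (measurable_fun_pair2 (z, w) (measurableT_comp mF measurable_walk)).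
- exact: (measurable_fun_pair2 (z, w') (measurableT_comp mF measurable_walk)).
by move=> g _; apply: Fmono; exact: walk_homo.
Qed.

Let excess (p : L * R) : R := Num.max 0%R p.2.

Let positive : set (L * R) := [set p | (0 < p.2)%R].

Let measurable_excess : measurable_fun setT excess.
Proof. by apply: measurable_maxr. Qed.

Let measurable_positive : measurable positive.
Proof. exact: measurable_snd_gt0. Qed.

Hypothesis mean_cost : \int[nu]_z \int[m]_g (cost (g, z))%:E <= (2^-1)%:E.

Let measurable_cost_swap : measurable_fun setT (fun q : L * G => (cost (q.2, q.1))%:E).
Proof.
apply/measurable_EFinP; apply: (measurableT_comp measurable_cost).
exact: measurable_swap.
Qed.

Let cost_swap_ge0 (q : L * G) : 0 <= (cost (q.2, q.1))%:E.
Proof. by rewrite lee_fin cost_ge0. Qed.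

(** A step adds its cost to the second coordinate, and subtracts 1 whenever the
    result is positive. *)
Lemma chain_balance n :
  \int[chain n.+1]_p (excess p)%:E + chain n.+1 positive <=
  \int[chain n]_p (excess p)%:E + (2^-1)%:E.
Proof.
pose F p := (excess p + \1_positive p)%:E.
have mF : measurable_fun setT F.
  by apply/measurable_EFinP; apply: measurable_funD => //; exact: measurable_indic.
have ex0 p : (0 <= excess p)%R by rewrite le_max lexx.
have F0 p : 0 <= F p by rewrite lee_fin addr_ge0.
pose c (z : L) := \int[m]_g (cost (g, z))%:E.
have mc : measurable_fun setT c.
  exact: (measurable_fun_fubini_tonelli_F _ measurable_cost_swap cost_swap_ge0).
have c0 z : 0 <= c z by apply: integral_ge0 => g _; rewrite lee_fin cost_ge0.
have mc1 : measurable_fun setT (fun p : L * R => c p.1).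
  exact: measurableT_comp mc measurable_fst.
have -> : \int[chain n.+1]_p (excess p)%:E + chain n.+1 positive =
    \int[chain n]_p mean_walk F p.
  apply: etrans (chainSE n mF F0).
  rewrite /F; under [RHS]eq_integral do rewrite EFinD.
  rewrite ge0_integralD//; last 3 first.
  - by move=> p _; rewrite lee_fin.
  - exact/measurable_EFinP.
  - by apply/measurable_EFinP; exact: measurable_indic.
  by rewrite (integral_indic (chain n.+1) measurableT measurable_positive) setIT.
apply: (@le_trans _ _ (\int[chain n]_p ((excess p)%:E + c p.1))%E).
  apply: ge0_le_integral => //.
  - by move=> p _; exact: mean_walk_ge0.
  - exact: measurable_mean_walk.
  - by apply: emeasurable_funD => //; exact/measurable_EFinP.
  move=> [z w] _.
  have mcz : measurable_fun setT (fun g : G => (cost (g, z))%:E).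
    exact: (measurable_fun_pair2 z measurable_cost_swap).
  have -> : (excess (z, w))%:E + c z = \int[m]_g ((excess (z, w))%:E + (cost (g, z))%:E).
    rewrite ge0_integralD//; last 2 first.
    - by move=> g _; rewrite lee_fin.
    - by move=> g _; rewrite lee_fin cost_ge0.
    by rewrite integral_cst// [X in _ * X]probability_setT mule1.
  apply: ge0_le_integral => //.
  - exact: (measurable_fun_pair2 (z, w) (measurableT_comp mF measurable_walk)).
  - by apply: emeasurable_funD.
  move=> g _; rewrite /F -EFinD lee_fin indicE.
  have -> : (walk (z, w, g) \in positive) = (0 < (walk (z, w, g)).2)%R.
    by apply/idP/idP; rewrite inE.
  rewrite /walk /excess /=.
  have := cost_ge0 (g, z); set k := cost _ => k0.
  have wle : (w <= Num.max 0 w)%R by rewrite le_max lexx orbT.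
  have w0 : (0 <= Num.max 0 w)%R by rewrite le_max lexx.
  have [pos|npos] := ltP 0%R (w + k - 1)%R.
    by rewrite !(max_r (ltW pos)) pos mulr1n; lra.
  by rewrite maxxx ltxx addr0 addr_ge0.
rewrite ge0_integralD//; last 2 first.
- by move=> p _; rewrite lee_fin.
- exact/measurable_EFinP.
by rewrite leeD2l// chain_fst.
Qed.

(** Garsia's proof of the maximal ergodic inequality: the mean of the second
    coordinate does not decrease with n, so what the steps subtract on average,
    the probability of being positive, is at most their mean cost. *)
Lemma chain_positive n : chain n positive <= (2^-1)%:E.
Proof.
have ex0 p : (0 <= excess p)%R by rewrite le_max lexx.
have mex : measurable_fun setT (EFin \o excess) by exact/measurable_EFinP.
have fin k : \int[chain k]_p (excess p)%:E < +oo.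
  elim: k => [|k ih].
    by rewrite chain0E//= /excess /= maxxx integral0 ltry.
  apply: le_lt_trans (lte_add_pinfty ih (ltry (2^-1)%R)).
  by apply: le_trans (chain_balance k); rewrite leeDl.
case: n => [|n].
  rewrite -[positive]setIT -(integral_indic (chain 0) measurableT measurable_positive).
  rewrite chain0E//; last by apply/measurable_EFinP; exact: measurable_indic.
  rewrite (eq_integral (cst 0)) ?integral0// => z _ /=.
  have np : ~ positive (z, 0%R) by rewrite /positive /= ltxx.
  by rewrite indicE memNset.
have f1 : \int[chain n.+1]_p (excess p)%:E \is a fin_num.
  by rewrite ge0_fin_numE// integral_ge0// => p _; rewrite lee_fin.
rewrite -(leeD2lE _ _ f1); apply: le_trans (chain_balance n) _.
rewrite leeD2r// chain_homo// => z w w' ww.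
by rewrite lee_fin /excess /= le_max2.
Qed.

Hypothesis small_images : forall b : L,
  m [set g | (vnorm (affinity_apply g 0 - b : 'cV[K]_d) <= 2 * delta)%R] <= (8^-1)%:E.

Definition slab (A : set L) (w : R) : set (L * R) := [set p | A p.1 /\ (p.2 <= w)%R].

Lemma measurable_slab A w : measurable A -> measurable (slab A w).
Proof.
move=> mA; rewrite (_ : slab A w = A `*` `]-oo, w]%classic); first exact: measurableX.
by apply/seteqP; split=> p /=; rewrite in_itv.
Qed.

Let chain_walk_indic n S g : measurable S ->
  \int[chain n]_p (\1_S (walk (p, g)))%:E = chain n [set p | S (walk (p, g))].
Proof.
move=> mS; have mSg : measurable [set p | S (walk (p, g))].
  rewrite -[X in measurable X]setTI.
  exact: (measurable_fun_pair1 g measurable_walk).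
by rewrite -[X in chain n X]setIT -(integral_indic (chain n) measurableT mSg).
Qed.

Lemma chain_setE n S : measurable S ->
  chain n.+1 S = \int[m]_g chain n [set p | S (walk (p, g))].
Proof.
move=> mS; have mI : measurable_fun setT (EFin \o \1_S : L * R -> \bar R).
  by apply/measurable_EFinP; exact: measurable_indic.
rewrite -[S in LHS]setIT -(integral_indic (chain n.+1) measurableT mS).
apply: etrans (random_image_swapE _ _ _ mI _) _; first by move=> p; rewrite lee_fin.
by apply: eq_integral => g _; exact: chain_walk_indic.
Qed.

Lemma measurable_chain_set n S : measurable S ->
  measurable_fun setT (fun g => chain n [set p | S (walk (p, g))]).
Proof.
move=> mS; have mI : measurable_fun setT (fun q => (\1_S (walk q))%:E : \bar R).
  apply/measurable_EFinP.
  exact: measurableT_comp (measurable_indic mS) measurable_walk.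
have I0 q : 0 <= (\1_S (walk q))%:E :> \bar R by rewrite lee_fin.
have := @measurable_fun_fubini_tonelli_G _ _ _ _ _ (chain n) _ mI I0.
by congr measurable_fun; apply/funext => g; exact: chain_walk_indic.
Qed.

(** The exponent for which the expansion of the diameter by preimages is paid by
    the part B log_size of the cost. *)
Definition ball_exponent : R := B * ln 2.

Lemma ball_exponent_gt0 : (0 < ball_exponent)%R.
Proof. by rewrite mulr_gt0// ln_gt0// ltr1n. Qed.

(** The first term is at least 1 as soon as D >= delta; the second one accounts
    for the smaller sets after only n steps. *)
Definition slab_bound n D w : R :=
  expR (w * ln 2) * (delta `^ (- ball_exponent) * D `^ ball_exponent + (3 / 4) ^+ n).

Lemma slab_bound_ge0 n D w : (0 <= slab_bound n D w)%R.
Proof.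
by rewrite mulr_ge0 ?expR_ge0// addr_ge0 ?mulr_ge0 ?powR_ge0// exprn_ge0// divr_ge0.
Qed.

Lemma slab_bound_pay n D w l : (0 <= D)%R -> (0 <= l)%R ->
  (slab_bound n (expR l * D) (w - B * l) <= slab_bound n D w)%R.
Proof.
move=> D0 l0; have ln20 : (0 < ln 2 :> R)%R by rewrite ln_gt0// ltr1n.
rewrite /slab_bound powRM ?expR_ge0// -expRM mulrBl expRD.
have -> : (- (B * l * ln 2) = - (l * ball_exponent))%R by rewrite /ball_exponent; ring.
rewrite expRN -mulrA ler_wpM2l ?expR_ge0// mulrDr lerD//.
  by rewrite [X in (_ * X)%R]mulrCA mulKf// gt_eqF ?expR_gt0.
rewrite ler_piMl ?exprn_ge0 ?divr_ge0// invf_le1 ?expR_gt0// -expR0 ler_expR.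
by rewrite mulr_ge0// ltW// ball_exponent_gt0.
Qed.

Lemma slab_boundD n D w k :
  slab_bound n D (w + k) = (expR (k * ln 2) * slab_bound n D w)%R.
Proof. by rewrite /slab_bound mulrDl expRD mulrA [X in (X * _)%R]mulrC. Qed.

Lemma chain_slab_neg n A w : measurable A -> (w < 0)%R -> chain n (slab A w) = 0.
Proof.
move=> mA w0; have mS := measurable_slab w mA; case: n => [|n].
  rewrite -[slab A w]setIT -(integral_indic (chain 0) measurableT mS).
  rewrite chain0E//; last by apply/measurable_EFinP; exact: measurable_indic.
  rewrite (eq_integral (cst 0)) ?integral0// => z _ /=.
  have nz : ~ slab A w (z, 0%R) by move=> -[_ /=]; rewrite leNgt w0.
  by rewrite indicE memNset.
rewrite chain_setE// (eq_integral (cst 0)) ?integral0// => g _ /=.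
rewrite (_ : [set p | _] = set0) ?measure0//.
apply/seteqP; split=> // p [_ /=]; rewrite ge_max => /andP[].
by rewrite leNgt w0.
Qed.

Lemma slab_bound_ge1 n D w : (0 <= w)%R -> (0 <= D)%R -> n = 0%N \/ (delta <= D)%R ->
  (1 <= slab_bound n D w)%R.
Proof.
move=> w0 D0 h; have e1 : (1 <= expR (w * ln 2))%R.
  by rewrite -[X in (X <= _)%R]expR0 ler_expR mulr_ge0// ltW// ln_gt0// ?ltr1n.
rewrite /slab_bound -[X in (X <= _)%R]mulr1 ler_pM//.
have q0 : (0 <= (3 / 4) ^+ n :> R)%R by rewrite exprn_ge0// divr_ge0.
have p0 : (0 <= delta `^ (- ball_exponent) * D `^ ball_exponent)%R by rewrite mulr_ge0 ?powR_ge0.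
case: h => [n0|dD]; first by rewrite n0 expr0 lerDr.
apply: (@le_trans _ _ (delta `^ (- ball_exponent) * D `^ ball_exponent)%R); last by rewrite lerDl.
rewrite powRN mulrC ler_pdivlMr ?powR_gt0// mul1r.
by rewrite ge0_ler_powR ?nnegrE// ?ltW// ball_exponent_gt0.
Qed.

(** By induction on the last step. The preimage of A is larger by a factor at most
    exp (log_size g), which slab_bound_pay balances. If A has diameter less than
    delta and contains the image of z, then either the image of 0 is close to A,
    which has probability at most 1/8 and multiplies the bound by 2, as w
    increases by 1; or the step is expanding and costs 2, which divides the bound
    by 2. Altogether the bound is multiplied by 2/8 + 1/2 = 3/4. *)
Lemma chain_slab n (A : set L) (D w : R) : measurable A -> (0 <= D)%R ->
  (forall x y, A x -> A y -> (vnorm (x - y : 'cV[K]_d) <= D)%R) ->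
  chain n (slab A w) <= (slab_bound n D w)%:E.
Proof.
elim: n A D w => [|n ih] A D w mA D0 diamA; have mS := measurable_slab w mA;
    have [w0|w0] := ltP w 0%R.
- by rewrite chain_slab_neg// lee_fin slab_bound_ge0.
- apply: (le_trans (probability_le1 _ mS)).
  by rewrite lee_fin slab_bound_ge1//; left.
- by rewrite chain_slab_neg// lee_fin slab_bound_ge0.
have [dD|Dd] := leP delta D.
  apply: (le_trans (probability_le1 _ mS)).
  by rewrite lee_fin slab_bound_ge1//; right.
have [A0|/set0P[b Ab]] := eqVneq A set0.
  rewrite (_ : slab A w = set0) ?measure0 ?lee_fin ?slab_bound_ge0//.
  by apply/seteqP; split=> // p []; rewrite A0.
rewrite chain_setE//.
pose M := slab_bound n D w; have M0 : (0 <= M)%R := slab_bound_ge0 n D w.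
pose N := [set g : G | (vnorm (affinity_apply g 0 - b : 'cV[K]_d) <= 2 * delta)%R].
have mN : measurable N by exact: measurable_image0_ball.
have slab_le g k :
    (forall p, slab A w (walk (p, g)) -> (p.2 <= w + k - B * log_size g)%R) ->
    chain n [set p | slab A w (walk (p, g))] <= (expR (k * ln 2) * M)%:E.
  move=> hk; pose Ag := [set z : L | A (affinity_apply g z)].
  have mAg : measurable Ag.
    rewrite -[Ag]setTI.
    exact: (measurable_fun_pair2 g (measurable_affinity_apply hK (d := d))).
  have l0 := log_size_ge0 g.
  apply: (@le_trans _ _ (chain n (slab Ag (w + k - B * log_size g)))).
    apply: le_measure; rewrite ?inE; last by move=> p Sp; split; [case: Sp|exact: hk].
    - rewrite -[X in measurable X]setTI.
      exact: (measurable_fun_pair1 g measurable_walk).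
    - exact: measurable_slab.
  apply: (le_trans (ih Ag (expR (log_size g) * D)%R _ mAg _ _)).
  - by rewrite mulr_ge0// expR_ge0.
  - move=> x y Ax Ay; apply: le_trans (vnorm_apply_inv g x y) _.
    rewrite ler_pM ?opnorm_ge0 ?vnorm_ge0//; last exact: diamA.
    rewrite (le_trans (le_expR_log_plus _))// ler_expR /log_size lerDr.
    exact: log_plus_ge0.
  - by rewrite /M -slab_boundD; exact: (slab_bound_pay n (w + k) D0 l0).
have walk_le g p : slab A w (walk (p, g)) -> (p.2 + cost (g, p.1) - 1 <= w)%R.
  by case=> _ /=; rewrite ge_max => /andP[].
apply: (@le_trans _ _ (\int[m]_g ((M / 2)%:E + (2 * M)%:E * (\1_N g)%:E))).
  apply: ge0_le_integral => //.
  - exact: measurable_chain_set.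
  - apply: emeasurable_funD => //; apply/measurable_EFinP.
    by apply: measurable_funM => //; exact: measurable_indic.
  move=> g _; rewrite indicE; have [/set_mem Ng|/negP gN] := boolP (g \in N).
    apply: (le_trans (slab_le g 1%R _)).
      move=> p /walk_le; have := log_size_ge0 g; rewrite /cost.
      have : (0 <= \1_expanding (g, p.1) :> R)%R by [].
      rewrite /=; lra.
    rewrite mul1r lnK ?posrE// mule1 -EFinD lee_fin; lra.
  apply: (le_trans (slab_le g (-1)%R _)).
    move=> p Sp; have := walk_le g p Sp; rewrite /cost indicE mem_set/=; last first.
      rewrite /expanding /= ltNge; apply/negP => small; apply: gN; rewrite inE /N /=.
      have -> : (affinity_apply g 0 - b =
          (affinity_apply g p.1 - b) - linear_part g *m p.1)%R.
        by rewrite -[X in linear_part g *m X]subr0 -affinity_applyB opprB [RHS]addrC addrA subrK.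
      rewrite (le_trans (vnormD _ _))// vnormN mulrDl mul1r lerD//.
      by rewrite (le_trans _ (ltW Dd))// diamA//; case: Sp.
    lra.
  rewrite mule0 adde0 lee_fin mulN1r expRN lnK ?posrE//; lra.
have mI : measurable_fun setT (fun g => (\1_N g)%:E : \bar R).
  by apply/measurable_EFinP; exact: measurable_indic.
rewrite (@ge0_integralD _ _ _ m _ measurableT (cst (M / 2)%:E)); last 4 first.
- by move=> g _; rewrite lee_fin divr_ge0.
- exact: measurable_cst.
- by move=> g _; rewrite mule_ge0 ?lee_fin// mulr_ge0.
- by apply: emeasurable_funM.
rewrite integral_cst// [X in _ * X + _]probability_setT mule1.
rewrite ge0_integralZl//; last by rewrite lee_fin mulr_ge0.
rewrite (integral_indic m measurableT mN) setIT.
apply: (@le_trans _ _ ((M / 2)%:E + (2 * M)%:E * (8^-1)%:E)).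
  rewrite leeD2l//; apply: lee_wpmul2l; first by rewrite lee_fin mulr_ge0.
  exact: small_images.
rewrite -EFinM -EFinD lee_fin.
apply: (@le_trans _ _ (3 / 4 * M)%R); first lra.
rewrite /M /slab_bound mulrCA ler_wpM2l ?expR_ge0// mulrDr exprS lerD2r.
by rewrite ler_piMl ?mulr_ge0 ?powR_ge0//; lra.
Qed.

End chain.

(** * Mass distribution *)

Section dimension_bound.
Context (R : realType) (K : absvFieldType R) (d : nat).
Hypothesis hK : local_field K.
Notation G := (borel (affinity K d)).
Notation L := (borel 'cV[K]_d).
Variables (m : probability G R) (nu : probability L R) (delta B : R).
Hypothesis inv : invariant_law m id nu.
Hypotheses (delta0 : 0 < delta) (B0 : 0 < B).
Hypothesis mean_cost :
  (\int[nu]_z \int[m]_g (cost delta B (g, z))%:E <= (2^-1)%:E)%E.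
Hypothesis small_images : forall b : L,
  (m [set g | (vnorm (affinity_apply g 0 - b : 'cV[K]_d) <= 2 * delta)%R] <= (8^-1)%:E)%E.

Let s := ball_exponent B.
Let cball (b : L) (r : R) : set L := [set x | vnorm (x - b : 'cV[K]_d) <= r].

(** For every n, at least 1/4 of the mass of the chain lies over the balls with a
    second coordinate equal to 0, and chain_slab bounds the mass over each ball;
    then n tends to infinity, with the finite family of balls fixed. *)
Lemma ball_cover_sum k (b : nat -> L) (r : nat -> R) : (forall i, 0 <= r i) ->
  (nu (~` \bigcup_(i < k) cball (b i) (r i)) <= (4^-1)%:E)%E ->
  4^-1 <= \sum_(i < k) (delta `^ (- s) * (2 * r i) `^ s).
Proof.
move=> r0; set U := \bigcup_(i < k) _ => nuU.
have mU : measurable U by apply: bigcup_measurable => i _; exact: measurable_cball.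
have mS i : measurable (slab (cball (b i) (r i)) 0 : set (L * R)).
  by apply: measurable_slab; exact: measurable_cball.
set S := \sum_(i < k) _.
have bound n : 4^-1 <= S + k%:R * (3 / 4) ^+ n.
  pose c := chain hK m nu delta B n.
  have cU : (c [set p | (~` U) p.1] <= (4^-1)%:E)%E.
    have mUC : measurable (~` U) by exact: measurableC.
    have mUC1 : measurable [set p : L * R | (~` U) p.1].
      by rewrite -[X in measurable X]setTI; exact: (@measurable_fst _ _ L R).
    rewrite -[X in c X]setIT -(integral_indic c measurableT mUC1).
    apply: le_trans nuU.
    rewrite -[X in (_ <= nu X)%E]setIT -(integral_indic nu measurableT mUC).
    have mI : measurable_fun setT (fun z : L => (\1_(~` U) z)%:E : \bar R).
      by apply/measurable_EFinP; exact: measurable_indic.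
    by rewrite -(chain_fst hK delta B inv n mI).
  have cP : (c [set p | (0 < p.2)%R] <= (2^-1)%:E)%E by exact: chain_positive.
  have cS i : (c (slab (cball (b i) (r i)) 0) <=
      (delta `^ (- s) * (2 * r i) `^ s + (3 / 4) ^+ n)%:E)%E.
    have -> : delta `^ (- s) * (2 * r i) `^ s + (3 / 4) ^+ n =
        slab_bound delta B n (2 * r i) 0.
      by rewrite /slab_bound mul0r expR0 mul1r.
    apply: chain_slab => //; [exact: measurable_cball|by rewrite mulr_ge0|].
    move=> x y xb yb; have -> : x - y = (x - b i) - (y - b i) :> 'cV[K]_d.
      by rewrite opprB addrA subrK.
    by rewrite (le_trans (vnormD _ _))// vnormN mulrDl mul1r lerD.
  pose V := \big[setU/set0]_(i < k) (slab (cball (b i) (r i)) 0 : set (L * R)).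
  have cover : [set: L * R] `<=` [set p | (~` U) p.1] `|` ([set p | (0 < p.2)%R] `|` V).
    move=> p _; have [Up|] := pselect (U p.1); last by left.
    right; have [p0|p0] := ltP 0 p.2; [by left|right].
    by rewrite /V -(bigcup_mkord k (fun i => slab (cball (b i) (r i)) 0)); case: Up => i ik pi; exists i.
  have mUC1 : measurable [set p : L * R | (~` U) p.1].
    rewrite -[X in measurable X]setTI.
    by apply: (@measurable_fst _ _ L R) => //; exact: measurableC.
  have mP1 : measurable [set p : L * R | (0 < p.2)%R] by exact: measurable_snd_gt0.
  have mV : measurable V by apply: bigsetU_measurable => i _; exact: mS.
  have cV : (c V <= (S + k%:R * (3 / 4) ^+ n)%:E)%E.
    have mSi i : (i < k)%N -> measurable (slab (cball (b i) (r i)) 0 : set (L * R)).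
      by move=> _; exact: mS.
    apply: (le_trans (Boole_inequality c mSi)).
    have -> : S + k%:R * (3 / 4) ^+ n =
        \sum_(i < k) (delta `^ (- s) * (2 * r i) `^ s + (3 / 4) ^+ n).
      by rewrite big_split /= sumr_const card_ord mulr_natl.
    by rewrite -sumEFin; apply: lee_sum => i _; exact: cS.
  have : (c setT <= (4^-1)%:E + ((2^-1)%:E + (S + k%:R * (3 / 4) ^+ n)%:E))%E.
    apply: (@le_trans _ _ (c ([set p | (~` U) p.1] `|` ([set p | (0 < p.2)%R] `|` V)))).
      by apply: le_measure => //; rewrite inE//; do 2 (apply: measurableU => //).
    apply: (le_trans (measureU2 _ _ _)) => //; first exact: measurableU.
    apply: leeD => //; apply: (le_trans (measureU2 _ _ _)) => //.
    exact: leeD.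
  by rewrite [X in (X <= _)%E]probability_setT -!EFinD lee_fin; lra.
have S0 : 0 <= S by apply: sumr_ge0 => i _; rewrite mulr_ge0 ?powR_ge0.
rewrite leNgt; apply/negP => S4.
pose e := (4^-1 - S) / k.+1%:R.
have e0 : 0 < e by rewrite divr_gt0// subr_gt0.
have : (3 / 4) ^+ n @[n --> \oo] --> (0 : R).
  by apply: cvg_expr; rewrite ger0_norm ?divr_ge0//; lra.
move=> /cvgrPdist_lt/(_ _ e0)[n _ /(_ n (leqnn n))].
rewrite sub0r normrN ger0_norm ?exprn_ge0 ?divr_ge0// => qe.
have := bound n; apply/negP; rewrite -ltNge -ltrBrDl.
have k1 : k.+1%:R * e = 4^-1 - S by rewrite /e mulrC divfK.
rewrite -k1; apply: (@le_lt_trans _ _ (k%:R * e)).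
  by rewrite ler_wpM2l// ltW.
by rewrite ltr_pM2r// ltr_nat.
Qed.

(** A cover of E with a small sum of powers of diameters would give, after
    replacing its sets by balls and keeping finitely many of them, a family
    forbidden by ball_cover_sum. *)
Lemma hausdorff_measure_neq0 (E : set 'cV[K]_d) (t : R) : 0 < t -> t <= s ->
  measurable (E : set L) -> nu E = 1%E -> hausdorff_measure t E <> 0%E.
Proof.
move=> t0 ts mE nuE Et.
pose C := delta `^ (- s) * 2 `^ s.
have C0 : 0 < C by rewrite mulr_gt0 ?powR_gt0.
(* Any value less than the inverse of 4 C does. *)
have e0 : 0 < (8 * C)^-1 by rewrite invr_gt0 mulr_gt0.
have pre : (hausdorff_premeasure t 1 E < ((8 * C)^-1)%:E)%E.
  apply: (@le_lt_trans _ _ 0%E); last by rewrite lte_fin.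
  by rewrite -Et; apply: ereal_sup_ubound; exists 1 => //=.
have [_ [U [EU U1] <-] Ue] := ereal_inf_lt pre.
have diam0 i : (0 <= diam (U i))%E by rewrite le_max lexx.
have diamf i : diam (U i) \is a fin_num.
  by rewrite ge0_fin_numE// (le_lt_trans (U1 i))// ltry.
pose r i := fine (diam (U i)).
have r0 i : 0 <= r i by rewrite fine_ge0.
have rE i : diam (U i) = (r i)%:E by rewrite /r fineK.
have r1 i : r i <= 1 by rewrite -lee_fin -rE.
have /choice[b bP] i : exists b : L, U i `<=` cball b (r i).
  have [->|/set0P[b Ub]] := eqVneq (U i) set0; first by exists 0.
  exists b => x Ux; rewrite /cball /= -mdist_vnorm -lee_fin -rE /diam.
  by rewrite le_max; apply/orP; right; apply: ereal_sup_ubound; exists x => //; exists b.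
pose A k := ~` \bigcup_(i < k) cball (b i) (r i).
have mA k : measurable (A k).
  by apply: measurableC; apply: bigcup_measurable => i _; exact: measurable_cball.
have ndA : {homo A : i j / (i <= j)%N >-> j `<=` i}.
  by move=> i j ij; apply: subsetC; apply: bigcup_subset => n /= /leq_trans; apply.
have A0 : nu (\bigcap_k A k) = 0%E.
  apply/eqP; rewrite -measure_le0.
  apply: (@le_trans _ _ (nu (~` E))).
    apply: le_measure; rewrite ?inE; [exact: bigcapT_measurable|exact: measurableC|].
    apply: subsetCr => x /EU[i _ Ux] /(_ i.+1 I); apply; exists i => //=.
    exact: bP.
  by rewrite probability_setC// nuE subee.
have q0 : 0 < 4^-1 :> R by rewrite invr_gt0.
have [k Ak] := exists_measure_le mA ndA A0 q0.
have := ball_cover_sum r0 Ak.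
apply/negP; rewrite -ltNge.
apply: (@le_lt_trans _ _ (C * \sum_(i < k) r i `^ t)).
  rewrite mulr_sumr; apply: ler_sum => i _.
  rewrite powRM// mulrA ler_wpM2l ?(ltW C0)//.
  have [->|ri0] := eqVneq (r i) 0.
    by rewrite !powR0 ?gt_eqF// ball_exponent_gt0.
  by rewrite ger_powR// lt_neqAle eq_sym ri0 r0 r1.
have sumle : ((\sum_(i < k) r i `^ t)%:E < ((8 * C)^-1)%:E)%E.
  apply: le_lt_trans Ue; rewrite -sumEFin.
  rewrite (eq_bigr (fun i : 'I_k => (diam (U i) `^ t)%E)); last first.
    by move=> i _; rewrite rE poweR_EFin.
  rewrite -(big_mkord xpredT (fun i => (diam (U i) `^ t)%E)).
  by apply: nneseries_lim_ge => i _ _; exact: poweR_ge0.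
rewrite lte_fin in sumle.
rewrite -ltr_pdivlMl//; apply: lt_le_trans sumle _.
by rewrite invfM mulrC ler_wpM2l ?invr_ge0 ?(ltW C0)//; lra.
Qed.

Lemma le_measure_hausdorff_dim : (s%:E <= measure_hausdorff_dim nu)%E.
Proof.
apply: le_ereal_inf_tmp => _ [E [mE nuE] <-].
apply: le_ereal_inf_tmp => _ [t [t0 Et] <-].
rewrite lee_fin leNgt; apply/negP => ts.
exact: (@hausdorff_measure_neq0 E t t0 (ltW ts) mE nuE Et).
Qed.

End dimension_bound.

(** * Choice of the steps *)

Section choice_of_block.
Context (R : realType) (K : absvFieldType R) (d : nat).
Hypothesis hK : local_field K.
Notation G := (borel (affinity K d)).
Notation L := (borel 'cV[K]_d).
Variables (m : probability G R) (nu : probability L R) (delta : R).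
Hypothesis inv : invariant_law m id nu.

Let expanding_indic_ge0 (p : G * L) : (0 <= (\1_(expanding delta) p)%:E :> \bar R)%E.
Proof. by rewrite lee_fin. Qed.

Let measurable_expanding_indic :
  measurable_fun setT (fun p : G * L => (\1_(expanding delta) p)%:E : \bar R).
Proof.
by apply/measurable_EFinP; apply: measurable_indic; exact: measurable_expanding.
Qed.

Let measurable_expanding_swap :
  measurable_fun setT (fun q : L * G => (\1_(expanding delta) (q.2, q.1))%:E : \bar R).
Proof.
exact: measurableT_comp measurable_expanding_indic (@measurable_swap _ _ L G).
Qed.

Lemma measurable_mean_expanding :
  measurable_fun setT (fun z : L => \int[m]_g (\1_(expanding delta) (g, z))%:E)%E.
Proof.
exact: (measurable_fun_fubini_tonelli_F _ measurable_expanding_swap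
  (fun q => expanding_indic_ge0 _)).
Qed.

Lemma measurable_expanding1 (z : L) :
  measurable_fun setT (fun g : G => (\1_(expanding delta) (g, z))%:E : \bar R).
Proof. exact: (measurable_fun_pair2 z measurable_expanding_swap). Qed.

(** An affinity with a small linear part expands only points that are far from
    the origin. *)
Lemma rarely_expanding (k : nat) (e : R) :
  (nu [set x | (k%:R <= vnorm x)%R] <= e%:E)%E ->
  (m [set g | (delta / k.+1%:R <= opnorm (linear_part g))%R] <= e%:E)%E ->
  (\int[nu]_z \int[m]_g (\1_(expanding delta) (g, z))%:E <= (e + e)%:E)%E.
Proof.
move=> far strong.
pose Z := [set x : L | (k%:R <= vnorm (x : 'cV[K]_d))%R].
pose A := [set g : G | (delta / k.+1%:R <= opnorm (linear_part g))%R].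
have mZ : measurable Z by exact: measurable_superlevel (@measurable_vnorm R K d).
have mA : measurable A by exact: measurable_opnorm_ge.
have mZ1 : measurable_fun setT (EFin \o \1_Z : L -> \bar R).
  by apply/measurable_EFinP; exact: measurable_indic.
have mA1 : measurable_fun setT (EFin \o \1_A : G -> \bar R).
  by apply/measurable_EFinP; exact: measurable_indic.
have le1 g z : \1_(expanding delta) (g, z) <= \1_Z z + \1_A g :> R.
  rewrite !indicE; case: (boolP ((g, z) \in _)) => [|_]; last by rewrite addr_ge0.
  rewrite inE /expanding /= => gz.
  have [|/negP zZ] := boolP (z \in Z); first by rewrite lerDl.
  have [|/negP gA] := boolP (g \in A); first by rewrite lerDr.
  have {}zZ : vnorm (z : 'cV[K]_d) < k%:R.
    by rewrite ltNge; apply/negP => h; apply: zZ; rewrite inE.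
  have {}gA : opnorm (linear_part g) < delta / k.+1%:R.
    by rewrite ltNge; apply/negP => h; apply: gA; rewrite inE.
  exfalso; move: gz; apply/negP; rewrite -leNgt (le_trans (opnormP _ _))//.
  apply: (@le_trans _ _ (delta / k.+1%:R * k.+1%:R)); last by rewrite divfK.
  rewrite ler_pM ?opnorm_ge0 ?vnorm_ge0//; first exact: ltW.
  by rewrite (le_trans (ltW zZ))// ler_nat.
apply: (@le_trans _ _ (\int[nu]_z ((\1_Z z)%:E + m A))%E).
  apply: ge0_le_integral => //.
  - by move=> z _; apply: integral_ge0 => g _; exact: expanding_indic_ge0.
  - exact: measurable_mean_expanding.
  - exact: emeasurable_funD.
  move=> z _; apply: (@le_trans _ _ (\int[m]_g ((\1_Z z)%:E + (\1_A g)%:E))%E).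
    apply: ge0_le_integral => //.
    - exact: measurable_expanding1.
    - exact: emeasurable_funD.
    - by move=> g _; rewrite -EFinD lee_fin; exact: le1.
  rewrite (@ge0_integralD _ _ _ m _ measurableT (cst (\1_Z z)%:E))//;
    last by move=> g _; rewrite lee_fin.
  rewrite integral_cst// [X in (_ * X + _)%E]probability_setT mule1.
  by rewrite (integral_indic m measurableT mA) setIT.
rewrite ge0_integralD//.
rewrite integral_cst// [X in (_ + _ * X)%E]probability_setT mule1.
rewrite (integral_indic nu measurableT mZ) setIT EFinD.
exact: leeD.
Qed.

(** When the step does not expand z, the image of 0 is close to the image of z,
    which has law nu. *)
Lemma small_images_of_small_balls (e e' : R) (b : L) :
  (\int[nu]_z \int[m]_g (\1_(expanding delta) (g, z))%:E <= e%:E)%E ->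
  (nu [set x : L | (vnorm (x - b : 'cV[K]_d) <= 3 * delta)%R] <= e'%:E)%E ->
  (m [set g | (vnorm (affinity_apply g 0 - b : 'cV[K]_d) <= 2 * delta)%R] <=
    (e' + e)%:E)%E.
Proof.
move=> rare small.
pose Q := [set x : L | (vnorm (x - b : 'cV[K]_d) <= 3 * delta)%R].
pose N := [set g : G | (vnorm (affinity_apply g 0 - b : 'cV[K]_d) <= 2 * delta)%R].
have mQ : measurable Q by exact: measurable_cball.
have mN : measurable N by exact: measurable_image0_ball.
have mQ1 : measurable_fun setT (fun x : L => (\1_Q x)%:E : \bar R).
  by apply/measurable_EFinP; exact: measurable_indic.
have mQ2 : measurable_fun setT
    (fun p : G * L => (\1_Q (affinity_apply p.1 p.2 : L))%:E : \bar R).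
  exact: measurableT_comp mQ1 (measurable_affinity_apply hK (d := d)).
have Q0 (x : L) : (0 <= (\1_Q x)%:E :> \bar R)%E by rewrite lee_fin.
have le1 g z : \1_N g <= \1_Q (affinity_apply g z : L) + \1_(expanding delta) (g, z) :> R.
  rewrite !indicE; case: (boolP (g \in N)) => [|_]; last by rewrite addr_ge0.
  rewrite inE /N /= => gN.
  have [|/negP gzE] := boolP ((g, z) \in expanding delta); first by rewrite lerDr.
  rewrite mem_set ?lerDl//; rewrite /Q /=.
  have -> : affinity_apply g z - b = linear_part g *m z + (affinity_apply g 0 - b).
    by rewrite -[X in linear_part g *m X]subr0 -affinity_applyB addrA subrK.
  have small_lin : vnorm (linear_part g *m z) <= delta.
    by rewrite leNgt; apply/negP => h; apply: gzE; rewrite inE.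
  rewrite (le_trans (vnormD _ _))//; lra.
have -> : (e' + e)%:E = (e'%:E + e%:E)%E by rewrite EFinD.
have fub : (\int[nu]_z \int[m]_g (\1_(expanding delta) (g, z))%:E =
    \int[m]_g \int[nu]_z (\1_(expanding delta) (g, z))%:E)%E.
  exact/esym/(@fubini_tonelli _ _ _ _ _ m nu _ measurable_expanding_indic
    expanding_indic_ge0).
rewrite fub in rare.
have invQ : (\int[m]_g \int[nu]_z (\1_Q (affinity_apply g z : L))%:E <= e'%:E)%E.
  apply: le_trans small; rewrite le_eqVlt; apply/orP; left; apply/eqP.
  apply: etrans (inv mQ1 Q0) _.
  by rewrite (integral_indic nu measurableT mQ) setIT.
apply: le_trans (leeD invQ rare).
have mF1 : measurable_fun setT
    (fun g : G => \int[nu]_z (\1_Q (affinity_apply g z : L))%:E : \bar R)%E.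
  exact: (measurable_fun_fubini_tonelli_F _ mQ2 (fun p => Q0 _)).
have mF2 : measurable_fun setT
    (fun g : G => \int[nu]_z (\1_(expanding delta) (g, z))%:E : \bar R)%E.
  exact: (measurable_fun_fubini_tonelli_F _ measurable_expanding_indic expanding_indic_ge0).
rewrite -ge0_integralD//; last 2 first.
- by move=> g _; apply: integral_ge0.
- by move=> g _; apply: integral_ge0.
rewrite -[X in m X]setIT -(integral_indic m measurableT mN).
apply: ge0_le_integral => //.
- by apply/measurable_EFinP; exact: measurable_indic.
- exact: emeasurable_funD.
move=> g _.
have mQg : measurable_fun setT (fun z : L => (\1_Q (affinity_apply g z : L))%:E : \bar R).
  exact: (measurable_fun_pair2 g mQ2).
have mEg : measurable_fun setT (fun z : L => (\1_(expanding delta) (g, z))%:E : \bar R).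
  exact: (measurable_fun_pair2 g measurable_expanding_indic).
rewrite -ge0_integralD//.
apply: (@le_trans _ _ (\int[nu]_z (cst (\1_N g)%:E z))%E).
  by rewrite integral_cst// [X in (_ <= _ * X)%E]probability_setT mule1.
apply: ge0_le_integral => //.
- by move=> z _; rewrite lee_fin.
- exact: emeasurable_funD.
- by move=> z _; rewrite -EFinD lee_fin; exact: le1.
Qed.

Lemma mean_cost_le (B e l : R) : 0 < B ->
  (\int[nu]_z \int[m]_g (\1_(expanding delta) (g, z))%:E <= e%:E)%E ->
  (\int[m]_g (log_size g)%:E = l%:E)%E ->
  (\int[nu]_z \int[m]_g (cost delta B (g, z))%:E <= (2 * e + B * l)%:E)%E.
Proof.
move=> B0 rare logl; have ml := @measurable_log_size R K d.
have mean z : (\int[m]_g (cost delta B (g, z))%:E =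
    2%:E * \int[m]_g (\1_(expanding delta) (g, z))%:E + (B * l)%:E)%E.
  under eq_integral do rewrite /cost EFinD EFinM EFinM.
  rewrite ge0_integralD//; last 3 first.
  - by apply: emeasurable_funM => //; exact: measurable_expanding1.
  - by move=> g _; rewrite mule_ge0// lee_fin ?(ltW B0)// log_size_ge0.
  - by apply: emeasurable_funM => //; exact/measurable_EFinP.
  rewrite ge0_integralZl//; last exact: measurable_expanding1.
  rewrite ge0_integralZl//; last 3 first.
  - exact/measurable_EFinP.
  - by move=> g _; rewrite lee_fin log_size_ge0.
  - by rewrite lee_fin ltW.
  by rewrite logl EFinM.
have l0 : 0 <= l.
  by rewrite -lee_fin -logl integral_ge0// => g _; rewrite lee_fin log_size_ge0.
under eq_integral do rewrite mean.
have E0 z : (0 <= \int[m]_g (\1_(expanding delta) (g, z))%:E :> \bar R)%E.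
  by apply: integral_ge0.
rewrite ge0_integralD//; last 3 first.
- by move=> z _; rewrite mule_ge0.
- by apply: emeasurable_funM => //; exact: measurable_mean_expanding.
- by move=> z _; rewrite lee_fin mulr_ge0// ltW.
rewrite ge0_integralZl//; last exact: measurable_mean_expanding.
rewrite integral_cst// [X in (_ + _ * X)%E]probability_setT mule1.
have -> : (2 * e + B * l)%:E = (2%:E * e%:E + (B * l)%:E)%E by rewrite EFinD EFinM.
by apply: leeD => //; apply: lee_wpmul2l.
Qed.

End choice_of_block.

Theorem corollary2p14
  (R : realType) (K : absvFieldType R) (hK : local_field K)
  (d : nat) (hd : (0 < d)%N)
  (mu : probability (borel (affinity K d)) R)
  (hmoment : moment_of_order_one mu)
  (hfix : forall M : set 'cV[K]_d, affine_subspace M -> M <> [set: 'cV[K]_d] ->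
    ~ (forall g : affinity K d, msupport mu g -> fixes g M))
  (hlyap : (lyapunov_exponent mu < 0)%E)
  (nu : probability (borel 'cV[K]_d) R)
  (hstat : stationary mu nu) :
  (0 < measure_hausdorff_dim nu)%E.
Proof.
have inv := stationary_invariant_law hK hstat.
have contr r e : 0 < r -> 0 < e -> exists m : probability (borel (affinity K d)) R,
    [/\ invariant_law m id nu, (\int[m]_g (log_size g)%:E < +oo)%E &
     (m [set g | (r <= opnorm (linear_part g))%R] <= e%:E)%E].
  by move=> r0 e0; exact: (contracting_block hK hd hmoment hlyap inv r0 e0).
have nu0 : forall x : borel 'cV[K]_d, nu [set x] = 0%E.
  apply: (atomless hK hd inv _ hfix) => r r0.
  have h0 : 0 < 2^-1 :> R by rewrite invr_gt0.
  by have [m [minv _ mr]] := contr r 2^-1 r0 h0; exists m.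
have e16 : 0 < 16^-1 :> R by rewrite invr_gt0.
have e32 : 0 < 32^-1 :> R by rewrite invr_gt0.
have [r r0 rP] := uniform_small_balls hK nu0 e16.
(* The image of 0 within 2 delta of b puts that of z within 3 delta = r of b. *)
pose delta := r / 3.
have delta0 : 0 < delta by rewrite divr_gt0.
have [k kP] := probability_far nu e32.
have [m [minv mlt mP]] := contr (delta / k.+1%:R) 32^-1 (divr_gt0 delta0 (ltr0Sn R k)) e32.
have exp16 := rarely_expanding hK kP mP.
have mean_log : (\int[m]_g (log_size g)%:E)%E \is a fin_num.
  by rewrite ge0_fin_numE// integral_ge0// => g _; rewrite lee_fin log_size_ge0.
pose l := fine (\int[m]_g (log_size g)%:E)%E.
have l0 : 0 <= l by apply: fine_ge0; apply: integral_ge0 => g _; rewrite lee_fin log_size_ge0.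
(* The mean cost is at most 2 / 16 + B * l, and B * l <= 1 / 4. *)
pose B := (4 * (l + 1))^-1.
have B0 : 0 < B by rewrite invr_gt0 mulr_gt0// ltr_wpDl.
have small b : (m [set g | (vnorm (affinity_apply g 0 - b : 'cV[K]_d) <= 2 * delta)%R] <=
    (8^-1)%:E)%E.
  have -> : 8^-1 = 16^-1 + (32^-1 + 32^-1) :> R by lra.
  apply: (small_images_of_small_balls hK minv exp16).
  have -> : 3 * delta = r by rewrite /delta mulrC divfK.
  exact: rP.
have mcost : (\int[nu]_z \int[m]_g (cost delta B (g, z))%:E <= (2^-1)%:E)%E.
  apply: le_trans (mean_cost_le hK B0 exp16 (esym (fineK mean_log))) _.
  have Bl : B * l <= 4^-1.
    by rewrite /B mulrC ler_pdivrMr ?mulr_gt0 ?ltr_wpDl//; lra.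
  by rewrite lee_fin -/l; lra.
apply: lt_le_trans (le_measure_hausdorff_dim hK minv delta0 B0 mcost small).
by rewrite lte_fin ball_exponent_gt0.
Qed.
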